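(* Suppose $n=2^s$ or $n=3\cdot 2^s$, $n\ge 8$. Then the map $\varphi_n:\mathrm{PU}_2(R_n)\to\mathbb H_n^\times/F_n^\times$ defined below is an isomorphism onto $\widetilde{\mathcal M}_n^\times/\underline R_n^\times$ (the image of $\widetilde{\mathcal M}_n^\times$ in $\mathbb H_n^\times/F_n^\times$).
   Context: $\zeta_n=e^{2\pi i/n}$, $K_n={\mathbf Q}(\zeta_n)$, $F_n={\mathbf Q}(\zeta_n+\zeta_n^{-1})$, $R_n={\mathbf Z}[\zeta_n,1/2]$, $\underline R_n={\mathbf Z}[\zeta_n+\zeta_n^{-1},1/2]$. $\mathbb H_n=F_n\otimes_{\mathbf Q}\mathbb H$ with $\mathbb H$ the Hamilton quaternions over ${\mathbf Q}$ with basis $1,i,j,k$, $i^2=j^2=k^2=-1$, $ij=-ji=k$, and $\widetilde{\mathcal M}_n=\underline R_n\langle1,i,j,(1+i+j+k)/2\rangle$. $\mathrm{PU}_2(R_n)$ is the group of $2\times2$ unitary matrices over $R_n$ modulo scalars. Definition of $\varphi_n$: for $A\in\mathrm U_2(K_n)$ with class $[A]$, write $\det A=\bar\beta/\beta$ with $\beta\in K_n^\times$ (Hilbert 90); then $A'=\beta A$ has $\det A'=\beta\bar\beta\in F_n$ and is of the form $\begin{pmatrix} r+s\sqrt{-1}& t+u\sqrt{-1}\\ -t+u\sqrt{-1}& r-s\sqrt{-1}\end{pmatrix}$ with $r,s,t,u\in F_n$; set $\varphi_n([A])$ to be the class of $r-ui-tj-sk$ in $\mathbb H_n^\times/F_n^\times$.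 *)

(* Defs.v *)
From HB Require Import structures.
From mathcomp Require Import all_boot all_order all_algebra all_field.
Set Implicit Arguments. Unset Strict Implicit. Unset Printing Implicit Defensive.
Import Order.TTheory GRing.Theory Num.Theory.
Local Open Scope ring_scope.

(* Everything lives inside algC (algebraic complex numbers); complex
   conjugation is x^* (Num.conj). z is a primitive n-th root of unity. *)

Definition in_Qadj (a x : algC) : Prop :=
  exists p : {poly rat}, x = (map_poly ratr p).[a].
Definition in_Zadj_half (a x : algC) : Prop :=
  exists (p : {poly int}) (k : nat), x = (map_poly intr p).[a] / 2%:R ^+ k.

Definition inK (z x : algC) := in_Qadj z x.
Definition inF (z x : algC) := in_Qadj (z + z^-1) x.
Definition inR (z x : algC) := in_Zadj_half z x.
Definition inRr (z x : algC) := in_Zadj_half (z + z^-1) x.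

Record quat := Quat { qr : algC; qi : algC; qj : algC; qk : algC }.

Definition qmul (p q : quat) : quat := Quat
  (qr p * qr q - qi p * qi q - qj p * qj q - qk p * qk q)
  (qr p * qi q + qi p * qr q + qj p * qk q - qk p * qj q)
  (qr p * qj q - qi p * qk q + qj p * qr q + qk p * qi q)
  (qr p * qk q + qi p * qj q - qj p * qi q + qk p * qr q).
Definition qone : quat := Quat 1 0 0 0.
Definition qscale (c : algC) (q : quat) : quat :=
  Quat (c * qr q) (c * qi q) (c * qj q) (c * qk q).

Definition inH (z : algC) (q : quat) : Prop :=
  [/\ inF z (qr q), inF z (qi q), inF z (qj q) & inF z (qk q)].

(* q ∈ Mtilde_n = underline R_n <1, i, j, (1+i+j+k)/2> *)
Definition inM (z : algC) (q : quat) : Prop :=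
  exists a b c d, [/\ inRr z a, inRr z b, inRr z c, inRr z d &
    q = Quat (a + d / 2%:R) (b + d / 2%:R) (c + d / 2%:R) (d / 2%:R)].

Definition inMunit (z : algC) (q : quat) : Prop :=
  inM z q /\ exists q', [/\ inM z q', qmul q q' = qone & qmul q' q = qone].

(* equality in H_n^× / F_n^× : q' = c q with c ∈ F_n^× *)
Definition qequiv (z : algC) (q q' : quat) : Prop :=
  exists c, [/\ inF z c, c != 0 & q' = qscale c q].

Definition mconj (A : 'M[algC]_2) : 'M[algC]_2 := (map_mx Num.conj A)^T.

Definition unitaryR (z : algC) (A : 'M[algC]_2) : Prop :=
  (forall i j, inR z (A i j)) /\ A *m mconj A = 1%:M.

(* equality in PU_2(R_n): A' = l A with l I a scalar unitary matrix over R_n *)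
Definition scal_equiv (z : algC) (A A' : 'M[algC]_2) : Prop :=
  exists l, [/\ inR z l, l * Num.conj l = 1 & A' = l *: A].

Definition m2 (a b c d : algC) : 'M[algC]_2 :=
  \matrix_(i < 2, j < 2)
    if val i == 0%N then (if val j == 0%N then a else b)
    else (if val j == 0%N then c else d).

(* q represents phi_n([A]): for some beta ∈ K_n^× with det A = conj(beta)/beta,
   beta A = [[r + s√-1, t + u√-1], [-t + u√-1, r - s√-1]] with r,s,t,u ∈ F_n,
   and q = r - u i - t j - s k. *)
Definition phi_rel (z : algC) (A : 'M[algC]_2) (q : quat) : Prop :=
  exists beta, [/\ inK z beta, beta != 0, \det A = Num.conj beta / beta &
    (exists r s t u, [/\ inF z r /\ inF z s, inF z t /\ inF z u,
      beta *: A = m2 (r + s * 'i) (t + u * 'i) (- t + u * 'i) (r - s * 'i) &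
      q = Quat r (- u) (- t) (- s)])].

(* Main.v *)
Require Import Defs.
From HB Require Import structures.
From mathcomp Require Import all_boot all_order all_algebra all_field.
From mathcomp Require Import ring zify.
Import Order.TTheory GRing.Theory Num.Theory.
Local Open Scope ring_scope.

(** Write [th = z + z^-1], [F = Q(th)] and [pi = 2 + th = |1 + z|^2]; here
    [1 + z] is a unit of [R_n].  The arithmetic input is of Weber type: if [nu] in
    [F] is a sum of squares [x^2] with every [x^2 / nu] integral away from 2 (so
    [nu] is totally positive and generates the square of an ideal away from 2),
    then [nu] is [f^2] or [pi f^2] with [f] in [F].  This is proved by descent along
    the tower of the [F_n].  Let [tau] be the automorphism [z |-> -z] and [F'] its
    fixed field in [F].  By induction the norm [nu * tau nu] is a square of [F'],
    possibly after replacing [nu] by [pi nu]; Hilbert 90 then replaces [nu] modulo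
    squares by an element of [F'], which is [1] or [th^2] modulo squares of [F'],
    hence a square in [F].  The tower ends at [Q] for [n = 4] and at [Q(sqrt 3)] for
    [n = 12].

    Applied to the reduced norm of a unit [m] of the quaternion order, this gives
    [N m = g g^*] with [g] in [R_n^x], so [g^-1 m] is a unitary matrix over [R_n].
    Applied to [|1 + d|^2], it shows that every [d] in [R_n] with
    [d d^* = 1] is [b^* / b] with [b] in [R_n^x], so that the image of [phi_n]
    consists of classes of units of the order. *)

(** * Subrings of [algC] and integrality away from [d] *)

Definition subring_of (S : algC -> Prop) :=
  [/\ S 1, (forall x y, S x -> S y -> S (x - y)) &
      (forall x y, S x -> S y -> S (x * y))].

Section SubringTheory.
Variables (S : algC -> Prop) (subS : subring_of S).

Lemma subring1 : S 1. Proof. by case: subS. Qed.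
Lemma subringB x y : S x -> S y -> S (x - y). Proof. by case: subS => _ + _; apply. Qed.
Lemma subringM x y : S x -> S y -> S (x * y). Proof. by case: subS => _ _; apply. Qed.
Lemma subring0 : S 0. Proof. by rewrite -(subrr 1); apply: subringB subring1 subring1. Qed.
Lemma subringN x : S x -> S (- x).
Proof. by rewrite -sub0r; apply/subringB/subring0. Qed.
Lemma subringD x y : S x -> S y -> S (x + y).
Proof. by move=> Sx Sy; rewrite -[y]opprK; apply/subringB/subringN. Qed.
Lemma subringX x k : S x -> S (x ^+ k).
Proof.
by move=> Sx; elim: k => [|k IH]; rewrite ?expr0 ?exprS; [apply: subring1 | apply: subringM].
Qed.
Lemma subring_nat k : S k%:R.
Proof. by elim: k => [|k IH]; rewrite ?mulrS; [apply: subring0 | apply/subringD/IH/subring1]. Qed.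
Lemma subring_int (k : int) : S k%:~R.
Proof. by case: k => k; [|rewrite NegzE rmorphN; apply: subringN]; apply: subring_nat. Qed.
Lemma subring_sum (I : Type) (r : seq I) (P : pred I) (f : I -> algC) :
  (forall i, P i -> S (f i)) -> S (\sum_(i <- r | P i) f i).
Proof. by move=> Sf; elim/big_ind: _ => //; [apply: subring0 | apply: subringD]. Qed.

End SubringTheory.

Ltac subring_tac H := repeat first
  [ assumption
  | exact: (subring1 _ H) | exact: (subring0 _ H)
  | apply: (subringB _ H) | apply: (subringN _ H) | apply: (subringD _ H)
  | apply: (subringX _ H) | apply: (subring_nat _ H)
  | apply: (subringM _ H) ].

Lemma subring_Qadj a : subring_of (in_Qadj a).
Proof.
split; first by exists 1; rewrite rmorph1 hornerC.
  by move=> _ _ [p ->] [q ->]; exists (p - q); rewrite rmorphB hornerD hornerN.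
by move=> _ _ [p ->] [q ->]; exists (p * q); rewrite rmorphM hornerM.
Qed.

Lemma Qadj_rat a q : in_Qadj a (ratr q).
Proof. by exists q%:P; rewrite map_polyC hornerC. Qed.

Lemma Qadj_gen a : in_Qadj a a.
Proof. by exists 'X; rewrite map_polyX hornerX. Qed.

Lemma two_neq0 : 2%:R != 0 :> algC. Proof. by rewrite pnatr_eq0. Qed.

Lemma subring_Zadj a : subring_of (in_Zadj_half a).
Proof.
have n0 k : (2 ^+ k != 0 :> algC) by rewrite expf_neq0 ?two_neq0.
split; first by exists 1, 0%N; rewrite rmorph1 hornerC expr0 divr1.
- move=> _ _ [p [k ->]] [q [l ->]].
  exists (p * (2%:R ^+ l)%:P - q * (2%:R ^+ k)%:P), (k + l)%N.
  rewrite rmorphB !rmorphM /= !map_polyC /= hornerD hornerN !hornerM !hornerC.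
  by rewrite !rmorphXn /= exprD; move: (n0 k) (n0 l) => ? ?; field; apply/andP.
- move=> _ _ [p [k ->]] [q [l ->]]; exists (p * q), (k + l)%N.
  by rewrite rmorphM hornerM exprD mulrACA invfM.
Qed.

Lemma Zadj_gen a : in_Zadj_half a a.
Proof. by exists 'X, 0%N; rewrite map_polyX hornerX expr0 divr1. Qed.

Lemma Zadj_half a : in_Zadj_half a 2%:R^-1.
Proof. by exists 1, 1%N; rewrite rmorph1 hornerC expr1 div1r. Qed.

Lemma horner_subring (S : algC -> Prop) (p : {poly algC}) x :
  subring_of S -> (forall i, S p`_i) -> S x -> S p.[x].
Proof.
move=> sS Sp Sx; rewrite horner_coef; apply: (subring_sum _ sS) => i _.
by apply: (subringM _ sS) => //; apply: subringX.
Qed.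

Lemma Zadj_sub a (S : algC -> Prop) x : subring_of S -> S 2%:R^-1 -> S a ->
  in_Zadj_half a x -> S x.
Proof.
move=> sS S2 Sa [p [k ->]]; rewrite -exprVn; apply: (subringM _ sS); last exact: subringX.
by apply: horner_subring => // i; rewrite coef_map; apply: subring_int.
Qed.

Lemma Qadj_sub a (S : algC -> Prop) x : subring_of S -> (forall q, S (ratr q)) -> S a ->
  in_Qadj a x -> S x.
Proof. by move=> sS Sq Sa [p ->]; apply: horner_subring => // i; rewrite coef_map; apply: Sq. Qed.

Lemma Zadj_Qadj a x : in_Zadj_half a x -> in_Qadj a x.
Proof.
apply: Zadj_sub; [exact: subring_Qadj | | exact: Qadj_gen].
by rewrite -(ratr_nat _ 2) -fmorphV; apply: Qadj_rat.
Qed.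

(** Splitting the minimal polynomial of [x] as [q * 'X + c] gives [x^-1 = - q(x) / c]; if [c] were
    0, then [q] would be a smaller polynomial vanishing at [x]. *)
Lemma QadjV a x : in_Qadj a x -> in_Qadj a x^-1.
Proof.
move=> Fx; have [->|x0] := eqVneq x 0; first by rewrite invr0; apply: subring0 (subring_Qadj a).
have [p [Dp mon_p] min_p] := minCpolyP x.
have [q [c Dpq]] : exists q c, p = q * 'X + c%:P.
  elim/poly_ind: p {Dp mon_p min_p} => [|q c _]; last by exists q, c.
  by exists 0, 0; rewrite mul0r add0r.
have px : (map_poly ratr q).[x] * x + ratr c = 0.
  have := root_minCpoly x; rewrite Dp Dpq rootE rmorphD rmorphM /= map_polyX map_polyC.
  by rewrite hornerD hornerM hornerX hornerC => /eqP.
have c0 : c != 0.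
  apply/eqP => c0; move: px; rewrite c0 rmorph0 addr0 => /eqP; rewrite mulf_eq0 (negPf x0) orbF.
  rewrite -rootE min_p => /dvdp_leq; rewrite Dpq c0 addr0.
  have q0 : q != 0.
    apply: contraTneq mon_p => q0.
    by rewrite Dpq q0 mul0r add0r c0 qualifE /= lead_coefC eq_sym oner_eq0.
  by move=> /(_ q0); rewrite size_mulX // ltnn.
have -> : x^-1 = - (map_poly ratr q).[x] * ratr c^-1.
  have c0' : ratr c != 0 :> algC by rewrite fmorph_eq0.
  apply: (mulIf x0); rewrite mulVf // fmorphV -mulrA [_ * x]mulrC mulrA mulNr.
  by move/eqP: px; rewrite addr_eq0 => /eqP->; rewrite opprK divff.
have sQ := subring_Qadj a.
apply: (subringM _ sQ); last exact: Qadj_rat.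
apply: (subringN _ sQ); apply: horner_subring => // i.
by rewrite coef_map; apply: Qadj_rat.
Qed.

(** For [d > 0] this is the ring of algebraic integers with [d] inverted. It is closed under square
    roots, so conditions on ideals can be tested on elements. *)
Definition dInt (d : nat) (x : algC) := exists k, d%:R ^+ k * x \in Aint.

Lemma dInt_Aint d x : x \in Aint -> dInt d x.
Proof. by exists 0%N; rewrite expr0 mul1r. Qed.

Lemma subring_dInt d : subring_of (dInt d).
Proof.
have dA k : d%:R ^+ k \in Aint by rewrite rpredX // rpred_nat.
split; first exact: dInt_Aint Aint1.
- move=> x y [k Ax] [l Ay]; exists (k + l)%N; rewrite mulrBr rpredB //.
    by rewrite addnC exprD -mulrA rpredM.
  by rewrite exprD -mulrA rpredM.
- by move=> x y [k Ax] [l Ay]; exists (k + l)%N; rewrite exprD mulrACA rpredM.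
Qed.

(** Substituting ['X^2] into the minimal polynomial of [x ^+ 2] gives a monic integral polynomial
    with root [x]. *)
Lemma Aint_sqrt x : x ^+ 2 \in Aint -> x \in Aint.
Proof.
move=> Ax; apply: (@root_monic_Aint (minCpoly (x ^+ 2) \Po 'X^2)).
- by rewrite rootE horner_comp hornerXn -rootE root_minCpoly.
- rewrite monicE lead_coef_comp ?size_polyXn // lead_coefXn expr1n mulr1.
  by rewrite -monicE minCpoly_monic.
- by rewrite polyOver_comp // rpredX // polyOverX.
Qed.

Lemma dInt_sqrt d x : dInt d (x ^+ 2) -> dInt d x.
Proof.
case=> k Ax; exists k; apply: Aint_sqrt; rewrite exprMn -exprM mulnC mulSn mul1n exprD -mulrA.
by rewrite rpredM // rpredX // rpred_nat.
Qed.

Lemma dInt_dvd d e x : (d %| e)%N -> dInt d x -> dInt e x.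
Proof.
move=> /dvdnP[m ->] [k Ax]; exists k; rewrite natrM exprMn -mulrA.
by rewrite rpredM // rpredX // rpred_nat.
Qed.

Lemma dInt_inv d m : (0 < m)%N -> (m %| d)%N -> dInt d m%:R^-1.
Proof.
move=> m0 /dvdnP[e ->]; exists 1%N; rewrite expr1 natrM mulfK ?rpred_nat //.
by rewrite pnatr_eq0 -lt0n.
Qed.

Lemma dInt_aut d (u : {rmorphism algC -> algC}) x : dInt d x -> dInt d (u x).
Proof. by case=> k Ax; exists k; rewrite -(rmorph_nat u d) -rmorphXn -rmorphM Aint_aut. Qed.

Lemma dInt_conj d x : dInt d x -> dInt d x^*.
Proof. exact: (dInt_aut d Num.conj). Qed.

Lemma Zadj_dInt a x : dInt 2 a -> in_Zadj_half a x -> dInt 2 x.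
Proof. by move=> ia; apply: Zadj_sub => //; [apply: subring_dInt | apply: dInt_inv]. Qed.

(** * The quadratic step of the tower *)

(* With [J = {x in F | x^2 / nu integral away from d}], this makes the ideal
   [(nu)] equal to [J^2] away from [d], and [nu] totally positive. *)
Definition sqrep d th nu := exists2 xs : seq algC,
  (forall x, x \in xs -> in_Qadj th x /\ dInt d (x ^+ 2 / nu)) &
  nu = \sum_(x <- xs) x ^+ 2.

Lemma sqrep_dvd d e th nu : (d %| e)%N -> sqrep d th nu -> sqrep e th nu.
Proof.
move=> de [xs Hx Dnu]; exists xs => // x /Hx[Fx ix]; split=> //; exact: dInt_dvd de ix.
Qed.

Lemma sqrepM d th mu nu : sqrep d th mu -> sqrep d th nu -> sqrep d th (mu * nu).
Proof.
move=> [xs Hx Dmu] [ys Hy Dnu]; exists [seq x * y | x <- xs, y <- ys].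
  move=> _ /allpairsP[[x y] /= [/Hx[Fx ix] /Hy[Fy iy] ->]]; split.
    exact: (subringM _ (subring_Qadj th)).
  by rewrite exprMn invfM mulrACA; apply: (subringM _ (subring_dInt d)).
rewrite {1}Dmu {1}Dnu big_distrlr big_allpairs_dep /=.
by apply: eq_bigr => x _; apply: eq_bigr => y _; rewrite exprMn.
Qed.

Lemma sqrep_sqr d th y : in_Qadj th y -> sqrep d th (y ^+ 2).
Proof.
move=> Fy; exists [:: y]; last by rewrite big_seq1.
move=> x; rewrite inE => /eqP->; split=> //; apply: dInt_Aint.
have [->|y0] := eqVneq y 0; first by rewrite expr0n mul0r Aint0.
by rewrite divff ?Aint1 // expf_neq0.
Qed.

(** For [th = z + z^-1] both alternatives are norms from [K] to [F]: [f] is real, and [2 + th] is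
    the norm of [1 + z]. *)
Definition sq_or_twisted_sq th nu :=
  exists2 f, in_Qadj th f & nu = f ^+ 2 \/ nu = (2%:R + th) * f ^+ 2.

Section QuadraticStep.
Variables (th : algC) (tau : {rmorphism algC -> algC}).
Hypotheses (tau_th : tau th = - th) (th_neq0 : th != 0).
(** For [th = z + z^-1] this is [z^2 + z^-2], the generator one level down. *)
Let th' := th ^+ 2 - 2%:R.

Lemma quad_th : th ^+ 2 = 2%:R + th'. Proof. by rewrite /th' addrC subrK. Qed.

Lemma quad_up x : in_Qadj th' x -> in_Qadj th x.
Proof.
have sQ := subring_Qadj th; apply: Qadj_sub => //; first exact: Qadj_rat.
have := Qadj_gen th => ?; rewrite /th'; subring_tac sQ.
Qed.

Lemma quad_fix x : in_Qadj th' x -> tau x = x.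
Proof.
apply: (Qadj_sub _ (fun x => tau x = x)).
- by split=> [|x0 y ex ey|x0 y ex ey]; rewrite ?rmorph1 // ?rmorphB ?rmorphM /= ex ey.
- by move=> q; rewrite fmorph_rat.
- by rewrite /th' rmorphB rmorphXn rmorph_nat /= tau_th sqrrN.
Qed.

Lemma quad_decomp x : in_Qadj th x ->
  exists a b, [/\ in_Qadj th' a, in_Qadj th' b & x = a + b * th].
Proof.
have sQ := subring_Qadj th'; have Fth' := Qadj_gen th'.
apply: (Qadj_sub _ (fun x => exists a b, [/\ in_Qadj th' a, in_Qadj th' b & x = a + b * th])).
- split.
  + by exists 1, 0; split; subring_tac sQ; rewrite mul0r addr0.
  + move=> _ _ [a [b [Fa Fb ->]]] [c [d [Fc Fd ->]]].
    by exists (a - c), (b - d); split; subring_tac sQ; ring.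
  + move=> _ _ [a [b [Fa Fb ->]]] [c [d [Fc Fd ->]]].
    exists (a * c + b * d * (2%:R + th')), (a * d + b * c); split; subring_tac sQ.
    by rewrite -quad_th; ring.
- by move=> q; exists (ratr q), 0; split; [exact: Qadj_rat | subring_tac sQ | rewrite mul0r addr0].
- by exists 0, 1; split; subring_tac sQ; rewrite add0r mul1r.
Qed.

(** Coordinates in the basis [1, th] over [Q(th')], expressed through [tau] so that integrality of
    [x] and [tau x] passes to them. *)
Definition quad_re x := (x + tau x) / 2%:R.
Definition quad_im x := (x - tau x) / (2%:R * th).

Lemma quad_coords x : in_Qadj th x ->
  [/\ in_Qadj th' (quad_re x), in_Qadj th' (quad_im x) & x = quad_re x + quad_im x * th].
Proof.
case/quad_decomp => a [b [Fa Fb Dx]].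
have tx : tau x = a - b * th by rewrite Dx rmorphD rmorphM /= tau_th !quad_fix // mulrN.
have -> : quad_re x = a by rewrite /quad_re tx Dx; field.
by have -> : quad_im x = b by rewrite /quad_im tx Dx; field.
Qed.

Lemma quad_aut x : in_Qadj th x -> in_Qadj th (tau x).
Proof.
case/quad_decomp => a [b [Fa Fb ->]]; rewrite rmorphD rmorphM /= tau_th !quad_fix //.
have sQ := subring_Qadj th; have := Qadj_gen th => Fth.
by subring_tac sQ; apply: quad_up.
Qed.

Lemma quad_norm x : in_Qadj th x -> in_Qadj th' (x * tau x).
Proof.
case/quad_decomp => a [b [Fa Fb ->]]; rewrite rmorphD rmorphM /= tau_th !quad_fix //.
have -> : (a + b * th) * (a + b * - th) = a ^+ 2 - b ^+ 2 * (2%:R + th').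
  by rewrite -quad_th; ring.
have sQ := subring_Qadj th'; have := Qadj_gen th' => Fth.
by subring_tac sQ.
Qed.

Lemma sqrep_aut d nu : sqrep d th nu -> sqrep d th (tau nu).
Proof.
case=> xs Hx Dnu; exists [seq tau x | x <- xs].
  move=> _ /mapP[x /Hx[Fx ix] ->]; split; first exact: quad_aut.
  by rewrite -rmorphXn -fmorph_div; apply: dInt_aut.
by rewrite {1}Dnu rmorph_sum big_map; apply: eq_bigr => x _; rewrite rmorphXn.
Qed.

(** With [x = a + b th], averaging [sum x^2] with its image under [tau] cancels the cross terms:
    [nu = sum (a^2 + b^2 th^2)], and [th^2] is itself a sum of squares [g^2]. The quotient
    [x tau(x) / nu] is integral because its square is the product of [x^2 / nu] and [tau(x)^2 / nu];
    this bounds the denominators of [a^2 / nu] and [b^2 / nu]. *)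
Lemma sqrep_descent d (gs : seq algC) nu :
  dInt d 2%:R^-1 -> dInt d th^-1 ->
  (forall g, g \in gs -> in_Qadj th' g /\ dInt d g) ->
  th ^+ 2 = \sum_(g <- gs) g ^+ 2 ->
  in_Qadj th' nu -> sqrep d th nu -> sqrep d th' nu.
Proof.
move=> i2 ith Hg Dth Fnu [xs Hx Dnu].
have sI := subring_dInt d; have sQ := subring_Qadj th'.
have cross x : dInt d (x ^+ 2 / nu) ->
  [/\ dInt d (x ^+ 2 / nu), dInt d ((tau x) ^+ 2 / nu) & dInt d (x * tau x / nu)].
  move=> ix; have itx : dInt d ((tau x) ^+ 2 / nu).
    by rewrite -(quad_fix nu Fnu) -rmorphXn -fmorph_div; apply: dInt_aut.
  split=> //; apply: dInt_sqrt.
  have -> : (x * tau x / nu) ^+ 2 = (x ^+ 2 / nu) * ((tau x) ^+ 2 / nu).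
    by rewrite expr_div_n exprMn [RHS]mulrACA -invfM.
  exact: (subringM _ sI).
exists ([seq quad_re x | x <- xs] ++ [seq quad_im x * g | x <- xs, g <- gs]).
  move=> y; rewrite mem_cat => /orP[/mapP[x /Hx[Fx /cross[ix itx ixt]] ->] |
                                    /allpairsP[[x g] /= [/Hx[Fx /cross[ix itx ixt]] /Hg[Fg ig] ->]]].
    have [Fre _ _] := quad_coords x Fx; split=> //.
    have -> : quad_re x ^+ 2 / nu = (x ^+ 2 / nu + (x * tau x / nu) * 2%:R + tau x ^+ 2 / nu)
       * 2%:R^-1 ^+ 2 by rewrite /quad_re; ring.
    by subring_tac sI.
  have [_ Fim _] := quad_coords x Fx; split; first exact: (subringM _ sQ).
  have -> : (quad_im x * g) ^+ 2 / nu = (x ^+ 2 / nu - (x * tau x / nu) * 2%:R + tau x ^+ 2 / nu)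
       * 2%:R^-1 ^+ 2 * (th^-1 ^+ 2) * g ^+ 2.
    by rewrite /quad_im invfM; ring.
  by subring_tac sI.
have -> : nu = \sum_(x <- xs) (quad_re x ^+ 2 + \sum_(g <- gs) (quad_im x * g) ^+ 2).
  have -> : nu = (nu + tau nu) / 2%:R by rewrite quad_fix //; field.
  rewrite {1 2}Dnu rmorph_sum -big_split big_distrl /=; apply: eq_bigr => x _.
  under [in RHS]eq_bigr do rewrite exprMn.
  by rewrite -big_distrr -Dth /= rmorphXn /quad_re /quad_im; field.
by rewrite big_cat big_map big_allpairs_dep big_split.
Qed.

(* Hilbert 90 for [nu / c]: with [rho = c + nu] one has [nu = c rho / tau rho]. *)
Lemma quad_norm_sqr nu c : in_Qadj th nu -> nu != 0 -> in_Qadj th' c -> nu * tau nu = c ^+ 2 ->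
  exists nu' y, [/\ in_Qadj th' nu', in_Qadj th y, y != 0 & nu = nu' * y ^+ 2].
Proof.
have sQ := subring_Qadj th; have sQ' := subring_Qadj th'.
(* The reduction is generalised over [c], which matters only up to sign: if [c + nu = 0], then
   [- c + nu = 2 nu] is nonzero. *)
move=> Fnu nu0; wlog rho0 : c / c + nu != 0.
  move=> IH Fc Dc; have [e|?] := eqVneq (c + nu) 0; last exact: IH Dc.
  apply: (IH (- c)); last by rewrite sqrrN.
    have -> : - c + nu = nu *+ 2.
      by transitivity (nu *+ 2 - (c + nu)); [ring | rewrite e subr0].
    by rewrite mulrn_eq0.
  by subring_tac sQ'.
move=> Fc Dc; set rho := c + nu.
have Frho : in_Qadj th rho by apply: (subringD _ sQ) => //; apply: quad_up.
have trho0 : tau rho != 0 by rewrite fmorph_eq0.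
(* [c rho / tau rho] is [c] times the norm of [rho], divided by the square of [tau rho]. *)
exists (c * (rho * tau rho)), (tau rho)^-1; split.
- by apply: (subringM _ sQ') => //; apply: quad_norm.
- exact/QadjV/quad_aut.
- by rewrite invr_eq0.
have -> : c * (rho * tau rho) * (tau rho)^-1 ^+ 2 = c * rho / tau rho by field.
apply: (mulIf trho0); rewrite mulfVK // /rho rmorphD /= quad_fix // mulrDr Dc; ring.
Qed.

Section Descent.
Hypotheses (ith : dInt 2 th) (ithV : dInt 2 th^-1).

(** As 2 and [th] are invertible away from 2, both coordinates of an integral element are integral,
    and the lower level applies to each. *)
Lemma quad_integral :
  (forall f, in_Qadj th' f -> dInt 2 f -> in_Zadj_half th' f) ->
  forall f, in_Qadj th f -> dInt 2 f -> in_Zadj_half th f.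
Proof.
move=> IH f Ff iF; have sI := subring_dInt 2; have sZ := subring_Zadj th.
have i2 : dInt 2 2%:R^-1 by apply: dInt_inv.
have Zth := Zadj_gen th; have itf := dInt_aut 2 tau f iF.
have up x : in_Zadj_half th' x -> in_Zadj_half th x.
  by apply: Zadj_sub => //; [exact: Zadj_half | rewrite /th'; subring_tac sZ].
have [Fre Fim ->] := quad_coords f Ff.
have ire : dInt 2 (quad_re f) by rewrite /quad_re; subring_tac sI.
have iim : dInt 2 (quad_im f) by rewrite /quad_im invfM; subring_tac sI.
by apply: (subringD _ sZ); [|apply: (subringM _ sZ) => //]; apply/up/IH.
Qed.

(** The norm of [nu] is a square or [2 + th'] times a square, by the lower level. The norm of
    [2 + th] is [4 - th^2], which equals [2 + th'] up to squares by the hypothesis on [h]; so in the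
    second case [nu * (2 + th)] has square norm. *)
Lemma quad_square (gs : seq algC) h :
  (forall g, g \in gs -> in_Qadj th' g /\ dInt 2 g) ->
  th ^+ 2 = \sum_(g <- gs) g ^+ 2 ->
  2%:R + th != 0 -> sqrep 2 th (2%:R + th) ->
  in_Qadj th' h -> (2%:R + th') * (4%:R - th ^+ 2) = h ^+ 2 ->
  (forall nu, in_Qadj th' nu -> sqrep 2 th' nu -> sq_or_twisted_sq th' nu) ->
  forall nu, in_Qadj th nu -> sqrep 2 th nu -> sq_or_twisted_sq th nu.
Proof.
move=> Hg Dg pi0 Spi Fh Dh IH nu Fnu Snu.
have sQ := subring_Qadj th; have sQ' := subring_Qadj th'; have Fth := Qadj_gen th.
have [->|nu0] := eqVneq nu 0.
  by exists 0; [exact: subring0 sQ | left; rewrite expr0n].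
have descent mu : in_Qadj th' mu -> sqrep 2 th mu -> sqrep 2 th' mu.
  by apply: (sqrep_descent 2 gs) => //; exact: dInt_inv.
have square mu c : in_Qadj th mu -> mu != 0 -> sqrep 2 th mu -> in_Qadj th' c ->
    mu * tau mu = c ^+ 2 -> exists2 f, in_Qadj th f & mu = f ^+ 2.
  move=> Fmu mu0 Smu Fc Dc.
  have [mu' [y [Fmu' Fy y0 Dmu]]] := quad_norm_sqr mu c Fmu mu0 Fc Dc.
  have /(descent _ Fmu')/(IH _ Fmu')[f Ff Df] : sqrep 2 th mu'.
    have -> : mu' = mu * y^-1 ^+ 2 by rewrite Dmu; field.
    by apply: sqrepM => //; apply/sqrep_sqr/QadjV.
  have {}Ff := quad_up f Ff.
  (* Since [2 + th' = th^2], the twisted alternative below becomes a square in [Q(th)]. *)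
  case: Df => Df; [exists (f * y) | exists (th * f * y)]; subring_tac sQ.
    by rewrite Dmu Df exprMn.
  by rewrite Dmu Df -quad_th !exprMn.
have [c Fc [Dc|Dc]] : sq_or_twisted_sq th' (nu * tau nu).
- by apply: IH; [exact: quad_norm | apply: descent; [exact: quad_norm | apply/sqrepM/sqrep_aut]].
- by have [f Ff Df] := square nu c Fnu nu0 Snu Fc Dc; exists f => //; left.
have [|||||f Ff Df] := square (nu * (2%:R + th)) (c * h).
- by subring_tac sQ.
- by rewrite mulf_neq0.
- exact: sqrepM.
- by subring_tac sQ'.
- rewrite rmorphM rmorphD rmorph_nat /= tau_th mulrACA Dc exprMn -Dh; ring.
exists (f / (2%:R + th)); first by apply: (subringM _ sQ) => //; apply: QadjV; subring_tac sQ.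
by right; rewrite expr_div_n -Df; field.
Qed.

End Descent.
End QuadraticStep.

(** * The bottom of the tower: [Q] and [Q(sqrt 3)] *)

Lemma Crat_dInt d x : x \in Crat -> dInt d x ->
  exists k (m : int), d%:R ^+ k * x = m%:~R.
Proof.
move=> Qx [k Ax]; exists k.
have : d%:R ^+ k * x \in Num.int.
  by apply: Cint_rat_Aint => //; rewrite rpredM // rpredX // rpred_nat.
by case/intrP => m Dm; exists m.
Qed.

Lemma dInt_inv_prime e p : prime p -> dInt e p%:R^-1 -> (p %| e)%N.
Proof.
move=> pr_p /Crat_dInt[|k [m Dm]]; first by rewrite rpredV rpred_nat.
have p0 : p%:R != 0 :> algC by rewrite pnatr_eq0 -lt0n prime_gt0.
have /(congr1 absz) : (e ^ k)%N%:Z = m * p%:Z.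
  by apply: (@intr_inj algC); rewrite rmorphM /= -Dm -!pmulrn mulfVK // natrX.
rewrite abszM /= => De; have : (p %| e ^ k)%N by rewrite De dvdn_mull.
by rewrite Euclid_dvdX // => /andP[].
Qed.

(** A suitable [y = d^k x] is a rational integer whose square is divisible by [p]; hence so is
    [y]. *)
Lemma dInt_sqr_div d p x : prime p -> x \in Crat -> dInt d (x ^+ 2 / p%:R) -> dInt d (x / p%:R).
Proof.
move=> pr_p Qx /[dup] ix2 /Crat_dInt[|k [m Dm]].
  by rewrite rpred_div ?rpredX // rpred_nat.
have p0 : p%:R != 0 :> algC by rewrite pnatr_eq0 -lt0n prime_gt0.
have Dx2 : (d%:R ^+ k * x) ^+ 2 = (p%:Z * (d%:Z ^+ k * m))%:~R.
  by rewrite !rmorphM rmorphXn /= -Dm -!pmulrn; field.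
have : d%:R ^+ k * x \in Num.int.
  apply: Cint_rat_Aint; first by rewrite rpredM // rpredX // rpred_nat.
  by apply: Aint_sqrt; rewrite Dx2 Aint_int.
case/intrP => y Dy; move: Dx2; rewrite Dy -rmorphXn /= => /intr_inj Ey.
have : (p%:Z %| y)%Z.
  have : (p %| `|y ^+ 2|)%N by rewrite Ey abszM /= dvdn_mulr.
  by rewrite abszX Euclid_dvdX // => /andP[].
case/dvdzP => v Dv; exists k; rewrite mulrA Dy Dv rmorphM /= -pmulrn mulfK // Aint_int //.
Qed.

Lemma sqfree_decomp n : (0 < n)%N -> exists m k, [/\ (0 < m)%N, (0 < k)%N,
  n = (m * k ^ 2)%N & forall p, prime p -> ~~ (p ^ 2 %| m)%N].
Proof.
elim/ltn_ind: n => n IH n0.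
have [/hasP[p _ /andP[pr_p /dvdnP[n' Dn]]]|/hasPn sf] :=
    boolP (has (fun p => prime p && (p ^ 2 %| n))%N (iota 0 n.+1)).
  have p1 := prime_gt1 pr_p; have n'0 : (0 < n')%N by move: n0; rewrite Dn muln_gt0 => /andP[].
  have [|//|m [k [m0 k0 Dn' sf]]] := IH n'; first by rewrite Dn; nia.
  exists m, (p * k)%N; split=> //; first by rewrite muln_gt0 k0 prime_gt0.
  by rewrite Dn Dn' expnMn; ring.
exists n, 1%N; split; rewrite ?muln1 // => p pr_p; apply/negP => p2n.
have /sf : p \in iota 0 n.+1.
  rewrite mem_iota ltnS; apply: leq_trans (dvdn_leq n0 p2n).
  by rewrite -{1}[p]expn1 leq_exp2l ?prime_gt1.
by rewrite pr_p p2n.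
Qed.

Lemma sqfree_dvdn m d : (0 < m)%N -> (forall p, prime p -> ~~ (p ^ 2 %| m)%N) ->
  (forall p, prime p -> (p %| m)%N -> (p %| d)%N) -> (m %| d)%N.
Proof.
move=> m0 sf Hd; apply/(dvdn_partP _ m0) => p; rewrite mem_primes => /and3P[pr_p _ pm].
rewrite p_part; have : (logn p m < 2)%N by rewrite ltnNge -pfactor_dvdn // sf.
by case: (logn p m) => [|[|]] // _; rewrite expn1 Hd.
Qed.

Lemma Qadj_Crat th x : th \in Crat -> in_Qadj th x -> x \in Crat.
Proof.
move=> Qth; apply: (Qadj_sub _ (fun x => x \in Crat)) => //; last exact: Crat_rat.
by split; [exact: rpred1 | move=> ? ?; apply: rpredB | move=> ? ?; apply: rpredM].
Qed.

Lemma Crat_Qadj th x : x \in Crat -> in_Qadj th x.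
Proof. by case/CratP => q ->; apply: Qadj_rat. Qed.

(** A nonzero sum of rational squares is positive, so [nu] is a squarefree [m > 0] times a square.
    Since the [x^2 / nu] sum to 1, a prime [p] dividing [m] but not [d] would make [1 / p] integral
    away from [d m / p], which is prime to [p]. *)
Lemma sqrep_Crat d th nu : th \in Crat -> nu != 0 -> sqrep d th nu ->
  exists m f, [/\ (m %| d)%N, f \in Crat, f != 0 & nu = m%:R * f ^+ 2].
Proof.
move=> Qth nu0 [xs Hx Dnu].
have Qx x : x \in xs -> x \in Crat by move=> /Hx[Fx _]; apply: Qadj_Crat Fx.
have Qnu : nu \in Crat by rewrite Dnu big_seq rpred_sum // => x /Qx; apply: rpredX.
have nu_gt0 : 0 < nu.
  rewrite lt_neqAle eq_sym nu0 Dnu big_seq sumr_ge0 // => x /Qx/Creal_Crat Rx.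
  by rewrite real_exprn_even_ge0.
have [q Dq] := CratP _ Qnu; have q0 : 0 < q by rewrite -(ltr0q algC) -Dq.
have [a Da] : exists a : nat, numq q = a by exists `|numq q|%N; rewrite gez0_abs // numq_ge0 ltW.
have [b Db] : exists b : nat, denq q = b by exists `|denq q|%N; rewrite gez0_abs // denq_ge0.
have b0 : (0 < b)%N by have := denq_gt0 q; rewrite Db.
have a0 : (0 < a)%N by have := q0; rewrite -numq_gt0 Da.
have b0' : b%:R != 0 :> algC by rewrite pnatr_eq0 -lt0n.
have [|m [k [m0 k0 Dab sf]]] := sqfree_decomp (a * b)%N; first by rewrite muln_gt0 a0.
have k0' : k%:R != 0 :> algC by rewrite pnatr_eq0 -lt0n.
have m0' : m%:R != 0 :> algC by rewrite pnatr_eq0 -lt0n.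
pose f : algC := k%:R / b%:R.
have f0 : f != 0 by rewrite mulf_neq0 // invr_eq0.
have Qf : f \in Crat by rewrite rpred_div // rpred_nat.
have Dm : nu = m%:R * f ^+ 2.
  have -> : nu = a%:R / b%:R by rewrite Dq -(divq_num_den q) fmorph_div Da Db /= !ratr_nat.
  apply: (mulIf b0'); apply: (mulIf b0').
  have /(congr1 (fun x => x%:R : algC)) := Dab; rewrite !natrM /f => E.
  by transitivity (a%:R * b%:R : algC); [|rewrite E]; field.
exists m, f; split=> //; apply: sqfree_dvdn => // p pr_p /dvdnP[m' Dm'].
have p0 : p%:R != 0 :> algC by rewrite pnatr_eq0 -lt0n prime_gt0.
have m'0 : (0 < m')%N by move: m0; rewrite Dm' muln_gt0 => /andP[].
have m'0' : m'%:R != 0 :> algC by rewrite pnatr_eq0 -lt0n.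
have sI := subring_dInt (d * m').
have : dInt (d * m') p%:R^-1.
  have -> : p%:R^-1 = \sum_(x <- xs) (x ^+ 2 / nu / p%:R).
    by rewrite -!big_distrl /= -Dnu divff // mul1r.
  rewrite big_seq; apply: (subring_sum _ sI) => x xxs.
  have [_ ix] := Hx _ xxs.
  (* Evenness of the valuation of [(x / f)^2] at [p] gains one factor [p]. *)
  have iy : dInt d (x / f / p%:R).
    apply: dInt_sqr_div => //; first by rewrite rpred_div // Qx.
    have -> : (x / f) ^+ 2 / p%:R = m'%:R * (x ^+ 2 / nu).
      by rewrite Dm Dm' natrM; field; rewrite m'0' p0 f0.
    by have sd := subring_dInt d; subring_tac sd.
  have -> : x ^+ 2 / nu / p%:R = (x / f / p%:R) ^+ 2 * m'%:R^-1.
    by rewrite Dm Dm' natrM; field; rewrite m'0' p0 f0.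
  apply: (subringM _ sI); last by apply: dInt_inv; rewrite // dvdn_mull.
  by apply: (subringX _ sI); apply: dInt_dvd iy; rewrite dvdn_mulr.
move/(dInt_inv_prime _ _ pr_p); rewrite Euclid_dvdM // => /orP[//|pm'].
by have := sf p pr_p; rewrite Dm' expnS expn1 mulnC dvdn_pmul2l ?prime_gt0 // pm'.
Qed.

Lemma Crat_dInt2 a x : x \in Crat -> dInt 2 x -> in_Zadj_half a x.
Proof.
move=> Qx /(Crat_dInt _ _ Qx)[k [m Dm]]; exists m%:P, k.
by rewrite map_polyC hornerC /= -Dm mulrC mulKf // expf_neq0 // two_neq0.
Qed.

Lemma weber_Q th : th = 0 -> forall nu, sqrep 2 th nu -> sq_or_twisted_sq th nu.
Proof.
move=> th0 nu Snu; have [->|nu0] := eqVneq nu 0.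
  by exists 0; [exact: subring0 (subring_Qadj th) | left; rewrite expr0n].
have Qth : th \in Crat by rewrite th0 rpred0.
have [m [f [m2 Qf f0 Df]]] := sqrep_Crat _ _ _ Qth nu0 Snu.
exists f; first exact: Crat_Qadj.
have : m \in divisors 2 by rewrite -dvdn_divisors.
rewrite !inE => /orP[] /eqP Dm; [left | right]; rewrite Df Dm ?mul1r //.
by rewrite th0 addr0.
Qed.

(** Infinite descent at 3: as 2 is not a square modulo 3, [a] and [c] are divisible by 3, and then
    so is [b]. Thus twice a nonzero rational square is not a norm from [Q(sqrt 3)]. *)
Lemma sqr_3sqr_2sqr (a b c : nat) : (a ^ 2 = 3 * b ^ 2 + 2 * c ^ 2)%N -> c = 0%N.
Proof.
elim/ltn_ind: c a b => c IH a b E; case: (posnP c) => // c0.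
have sq3 x : (x ^ 2 %% 3 = (x %% 3 != 0%N))%N.
  rewrite -modnXm; have := ltn_pmod x (isT : 0 < 3)%N.
  by case: (x %% 3)%N => [|[|[|]]].
have /(congr1 (modn^~ 3%N)) := E; rewrite mulnC modnMDl -modnMmr sq3 sq3.
case: (boolP (a %% 3 != 0)%N) => a3; case: (boolP (c %% 3 != 0)%N) => c3 //= _.
move/negPn: a3 => /dvdnP[a' Da]; move/negPn: c3 => /dvdnP[c' Dc].
have Eb : (b ^ 2 = 3 * (a' ^ 2 - 2 * c' ^ 2))%N by move: E; rewrite Da Dc !expnMn; lia.
have : (3 %| b ^ 2)%N by rewrite Eb dvdn_mulr.
rewrite Euclid_dvdX // => /andP[/dvdnP[b' Db] _].
have := IH c' _ a' b'; rewrite Dc => -> //; first lia.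
by move: E; rewrite Da Db Dc !expnMn; lia.
Qed.

Lemma Crat_sqr_3sqr_2sqr (a b c : algC) : a \in Crat -> b \in Crat -> c \in Crat ->
  a ^+ 2 = 3%:R * b ^+ 2 + 2%:R * c ^+ 2 -> c = 0.
Proof.
move=> /CratP[p ->] /CratP[q ->] /CratP[r ->] E.
have {}E : p ^+ 2 = 3%:R * q ^+ 2 + 2%:R * r ^+ 2.
  by apply: (fmorph_inj (@ratr algC)); rewrite rmorphD !(rmorphXn, rmorphM) /= !ratr_nat.
have d0 (x : rat) : (denq x)%:~R != 0 :> rat by rewrite intr_eq0 denq_neq0.
have Ez : (numq p * denq q * denq r) ^+ 2 =
  3%:R * (numq q * denq p * denq r) ^+ 2 + 2%:R * (numq r * denq p * denq q) ^+ 2.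
  apply: (@intr_inj rat); rewrite rmorphD !(rmorphXn, rmorphM) /= !numqE.
  transitivity ((p * (denq p)%:~R * (denq q)%:~R * (denq r)%:~R) ^+ 2); first ring.
  by rewrite !exprMn E; ring.
have /(sqr_3sqr_2sqr _ _ _)/eqP :
  (`|(numq p * denq q * denq r)%R| ^ 2 = 3 * `|(numq q * denq p * denq r)%R| ^ 2 +
    2 * `|(numq r * denq p * denq q)%R| ^ 2)%N.
  apply/eqP; rewrite -eqz_nat PoszD !PoszM !abszE; apply/eqP.
  by rewrite -!expr2 !real_normK ?num_real.
rewrite absz_eq0 !mulf_eq0 !(negPf (denq_neq0 _)) !orbF numq_eq0 => /eqP->.
by rewrite rmorph0.
Qed.

Section Sqrt3.
Variables (th : algC) (tau : {rmorphism algC -> algC}).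
Hypotheses (tau_th : tau th = - th) (th_sq : th ^+ 2 = 3%:R).
Local Notation th' := (th ^+ 2 - 2%:R).

Let th_neq0 : th != 0. Proof. by have := pnatr_eq0 algC 3; rewrite -th_sq expf_eq0 => /negbT. Qed.
(** Here [th' = 1], so the lower field is [Q]. *)
Let Qth' : th' \in Crat. Proof. by rewrite th_sq rpredB // rpred_nat. Qed.
Let sI := subring_dInt 2.
Let i2 : dInt 2 2%:R^-1. Proof. exact: dInt_inv. Qed.
Let ith : dInt 2 th. Proof. by apply: dInt_sqrt; rewrite th_sq; subring_tac sI. Qed.

Lemma sqrt3_coords x : in_Qadj th x ->
  [/\ quad_re tau x \in Crat, quad_im th tau x \in Crat &
      x = quad_re tau x + quad_im th tau x * th].
Proof.
by case/(quad_coords th tau tau_th th_neq0) => /(Qadj_Crat _ _ Qth') ? /(Qadj_Crat _ _ Qth').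
Qed.

(** Away from 2 alone, [th] is not invertible. Instead [(3 b)^2 / 3 = (b th)^2] is integral for the
    second coordinate [b], and [b] is rational, so [3 b] is divisible by 3. *)
Lemma sqrt3_coords_dInt x : in_Qadj th x -> dInt 2 x ->
  dInt 2 (quad_re tau x) /\ dInt 2 (quad_im th tau x).
Proof.
move=> Fx ix; have itx := dInt_aut 2 tau x ix; split; first by rewrite /quad_re; subring_tac sI.
have [_ Qb _] := sqrt3_coords x Fx; set b := quad_im _ _ _ in Qb *.
have -> : b = 3%:R * b / 3%:R by field.
apply: dInt_sqr_div => //; first by rewrite rpredM // rpred_nat.
have -> : (3%:R * b) ^+ 2 / 3%:R = ((x - tau x) / 2%:R) ^+ 2.
  have -> : (x - tau x) / 2%:R = b * th by rewrite /b /quad_im; field.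
  by rewrite [(b * th) ^+ 2]exprMn th_sq; field.
by subring_tac sI.
Qed.

Lemma sqrt3_integral f : in_Qadj th f -> dInt 2 f -> in_Zadj_half th f.
Proof.
move=> Ff iF; have [ia ib] := sqrt3_coords_dInt f Ff iF.
have [Qa Qb ->] := sqrt3_coords f Ff; have sZ := subring_Zadj th.
apply: (subringD _ sZ); first exact: Crat_dInt2.
by apply: (subringM _ sZ); [exact: Crat_dInt2 | exact: Zadj_gen].
Qed.

(* The valuation of [nu] at [th] is even, hence that of its norm at 3 too. *)
Lemma sqrt3_norm_even nu (e : nat) c : in_Qadj th nu -> sqrep 2 th nu ->
  (0 < e)%N -> (e %| 2)%N -> c \in Crat -> c != 0 -> nu * tau nu = (3 * e)%:R * c ^+ 2 -> False.
Proof.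
move=> Fnu [xs Hx Dnu] e0 e2 Qc c0 DN; have sQ := subring_Qadj th.
have e0' : e%:R != 0 :> algC by rewrite pnatr_eq0 -lt0n.
have ie : dInt 2 e%:R^-1 by exact: dInt_inv.
have /andP[nu0 tnu0] : (nu != 0) && (tau nu != 0).
  by rewrite -negb_or -mulf_eq0 DN mulf_neq0 ?expf_neq0 // pnatr_eq0 muln_eq0 negb_or -!lt0n.
(* The contradiction will be that [th] is invertible away from 2: as the [w = x^2 / nu] sum to 1, it
   suffices that each [w / th] is integral. *)
suff : dInt 2 3%:R^-1 by move/(dInt_inv_prime _ 3 isT).
have -> : 3%:R^-1 = (th^-1 : algC) ^+ 2 by rewrite exprVn th_sq.
apply: (subringX _ sI).
have -> : th^-1 = \sum_(x <- xs) (x ^+ 2 / nu / th) by rewrite -!big_distrl /= -Dnu divff // mul1r.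
rewrite big_seq; apply: (subring_sum _ sI) => x /Hx[Fx iw].
set w := _ / nu in iw *; have itw := dInt_aut 2 tau w iw.
have Fw : in_Qadj th w by have := QadjV _ _ Fnu => Fnu'; rewrite /w; subring_tac sQ.
have [ia ib] := sqrt3_coords_dInt w Fw iw; have [Qa Qb Dw] := sqrt3_coords w Fw.
set a := quad_re _ _ in ia Qa Dw; set b := quad_im _ _ _ in ib Qb Dw.
clearbody a b.
have tauF v : in_Qadj th' v -> tau v = v by exact: quad_fix.
have Dtw : tau w = a - b * th.
  by rewrite Dw rmorphD rmorphM /= tau_th mulrN !tauF //; apply: Crat_Qadj.
have Ds : w * tau w = a ^+ 2 - 3%:R * b ^+ 2 by rewrite Dtw Dw -th_sq; ring.
have Qy : x * tau x / c \in Crat.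
  by rewrite rpred_div //; apply: (Qadj_Crat _ _ Qth'); apply: quad_norm.
(* The square of the rational number [x tau(x) / c] is [3 e] times the norm of [w], so that number
   is divisible by 3. Then 3 divides the norm [a^2 - 3 b^2] of [w], hence [a], and [th] divides
   [w]. *)
have iy : dInt 2 (x * tau x / c / 3%:R).
  apply: dInt_sqr_div => //.
  have -> : (x * tau x / c) ^+ 2 / 3%:R = e%:R * (w * tau w).
    rewrite /w fmorph_div rmorphXn /=.
    have -> : x ^+ 2 / nu * (tau x ^+ 2 / tau nu) = (x * tau x) ^+ 2 / (nu * tau nu).
      by rewrite mulrACA -invfM -exprMn.
    by rewrite DN natrM; field; rewrite c0 e0'.
  by subring_tac sI.
have it : dInt 2 (w * tau w / 3%:R).
  have -> : w * tau w / 3%:R = (x * tau x / c / 3%:R) ^+ 2 / e%:R.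
    rewrite /w fmorph_div rmorphXn /=.
    have -> : x ^+ 2 / nu * (tau x ^+ 2 / tau nu) = (x * tau x) ^+ 2 / (nu * tau nu).
      by rewrite mulrACA -invfM -exprMn.
    by rewrite DN natrM; field; rewrite c0 e0'.
  by subring_tac sI.
have ia3 : dInt 2 (a / 3%:R).
  apply: dInt_sqr_div => //.
  have -> : a ^+ 2 / 3%:R = w * tau w / 3%:R + b ^+ 2 by rewrite Ds; field.
  by apply: (subringD _ sI) => //; apply: (subringX _ sI).
have -> : w / th = a / 3%:R * th + b.
  by rewrite {1}Dw -th_sq; field.
by apply: (subringD _ sI) => //; apply: (subringM _ sI).
Qed.

Lemma weber_sqrt3 nu : in_Qadj th nu -> sqrep 2 th nu -> sq_or_twisted_sq th nu.
Proof.
move=> Fnu Snu; have [->|nu0] := eqVneq nu 0.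
  by exists 0; [exact: subring0 (subring_Qadj th) | left; rewrite expr0n].
have sQ := subring_Qadj th; have sQ' := subring_Qadj th'; have Fth := Qadj_gen th.
(* Descending to [Q] divides by [th], so 3 has to be inverted too; this is why 6 replaces 2. The
   three ones express [th^2 = 3]. *)
have rational mu : in_Qadj th' mu -> mu != 0 -> sqrep 2 th mu ->
    exists m f, [/\ (m %| 6)%N, f \in Crat, f != 0 & mu = m%:R * f ^+ 2].
  move=> Fmu mu0 Smu; apply: (sqrep_Crat 6 th') => //.
  apply: (sqrep_descent th tau tau_th th_neq0 6 [:: 1; 1; 1]) => //.
  - exact: dInt_inv.
  - by apply: dInt_sqrt; rewrite exprVn th_sq; apply: dInt_inv.
  - move=> g; rewrite !inE => /or3P[] /eqP->; split; try exact: subring1 sQ';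
      exact: subring1 (subring_dInt 6).
  - by rewrite !big_cons big_nil th_sq !expr1n; ring.
  - exact: sqrep_dvd Smu.
have div6 m : (m %| 6)%N -> [\/ m = 1, m = 2, m = 3 | m = 6]%N.
  rewrite dvdn_divisors // !inE => /or4P[] /eqP->;
    by [constructor 1|constructor 2|constructor 3|constructor 4].
have FN := quad_norm th tau tau_th nu Fnu.
have [||m [c [/div6 Hm Qc c0 Dc]]] := rational _ FN.
- by rewrite mulf_neq0 // fmorph_eq0.
- exact/sqrepM/sqrep_aut.
(* The value 2 is excluded by the descent at 3, and 3 and 6 by the even valuation at [th]. *)
have {Hm} Dm : m = 1%N.
  case: Hm => Dm //; rewrite Dm in Dc.
  - have [Qa Qb Dnu] := sqrt3_coords nu Fnu.
    have tauF v : v \in Crat -> tau v = v.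
      by move=> Qv; apply: (quad_fix th) => //; exact: Crat_Qadj.
    set a := quad_re _ _ in Qa Dnu; set b := quad_im _ _ _ in Qb Dnu; clearbody a b.
    case/eqP: c0; apply: (Crat_sqr_3sqr_2sqr _ _ _ Qa Qb Qc).
    rewrite -Dc Dnu rmorphD rmorphM /= tau_th !tauF // -th_sq; ring.
  - by case: (sqrt3_norm_even nu 1 c).
  - by case: (sqrt3_norm_even nu 2 c).
have [|nu' [y [Fnu' Fy y0 Dnu]]] := quad_norm_sqr th tau tau_th nu c Fnu nu0 (Crat_Qadj _ _ Qc).
  by rewrite Dc Dm mul1r.
have nu'0 : nu' != 0 by apply: contraNneq nu0 => e; rewrite Dnu e mul0r.
have [|k [f [/div6 Hk Qf f0 Df]]] := rational nu' Fnu' nu'0.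
  have -> : nu' = nu * y^-1 ^+ 2 by rewrite Dnu; field.
  by apply: sqrepM => //; apply/sqrep_sqr/QadjV.
have Ff : in_Qadj th f by apply: Crat_Qadj.
(* Modulo squares of [Q(th)], 2 is therefore [2 + th], while [3 = th^2] is trivial; this settles all
   four divisors of 6. *)
have E2 : (1 + th) ^+ 2 = 2%:R * (2%:R + th).
  by transitivity (1 + 2%:R * th + th ^+ 2); [ring | rewrite th_sq; ring].
have th1 : 1 + th != 0.
  apply/eqP => /eqP; rewrite addrC addr_eq0 => /eqP e; have := th_sq.
  by rewrite e sqrrN expr1n => /eqP; rewrite (eqr_nat algC 1 3).
have F1 : in_Qadj th (1 + th)^-1 by apply: QadjV; subring_tac sQ.
have twist v : 2%:R * v ^+ 2 = (2%:R + th) * (2%:R * (1 + th)^-1 * v) ^+ 2.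
  by apply: (mulIf (expf_neq0 2 th1)); rewrite {1}E2; field.
case: Hk => Dk; rewrite Dnu Df Dk.
- by exists (f * y); subring_tac sQ; left; ring.
- exists (2%:R * (1 + th)^-1 * (f * y)); subring_tac sQ.
  by right; rewrite -twist; ring.
- by exists (th * f * y); subring_tac sQ; left; rewrite !exprMn th_sq.
- exists (2%:R * (1 + th)^-1 * (th * f * y)); subring_tac sQ.
  by right; rewrite -twist !exprMn th_sq; ring.
Qed.
End Sqrt3.

(** * Cyclotomic fields *)

Lemma conj_prim_root n (z : algC) : n.-primitive_root z -> z^* = z^-1.
Proof.
move=> pz; have n0 := prim_order_gt0 pz.
have : `|z| ^+ n == 1 by rewrite -normrX (prim_expr_order pz) normr1.
by rewrite pexpr_eq1 ?normr_ge0 // => /eqP nz; rewrite invC_norm nz expr1n invr1 mul1r.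
Qed.

Section Conj.
Variable z : algC.
Hypotheses (z0 : z != 0) (zc : z^* = z^-1) (FzV : in_Zadj_half z z^-1).

Lemma conj_Qadj x : in_Qadj z x -> in_Qadj z x^*.
Proof.
have FzV' := Zadj_Qadj _ _ FzV; have sQ := subring_Qadj z.
apply: (Qadj_sub _ (fun x => in_Qadj z x^*)); last by rewrite zc.
  split; rewrite ?rmorph1 => *; rewrite ?rmorphB ?rmorphM /=; subring_tac sQ.
by move=> q; rewrite fmorph_rat; apply: Qadj_rat.
Qed.

Lemma conj_Zadj x : in_Zadj_half z x -> in_Zadj_half z x^*.
Proof.
have sQ := subring_Zadj z.
apply: (Zadj_sub _ (fun x => in_Zadj_half z x^*)); last by rewrite zc.
  split; rewrite ?rmorph1 => *; rewrite ?rmorphB ?rmorphM /=; subring_tac sQ.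
by rewrite fmorphV rmorph_nat; apply: Zadj_half.
Qed.

(** The Chebyshev recurrence; the induction carries two consecutive exponents. *)
Lemma sym_pow_subring (S : algC -> Prop) k : subring_of S -> S (z + z^-1) ->
  S (z ^+ k + z^-1 ^+ k).
Proof.
move=> sS Sz; suff [] : S (z ^+ k + z^-1 ^+ k) /\ S (z ^+ k.+1 + z^-1 ^+ k.+1) by [].
elim: k => [|k [IH1 IH2]]; first by rewrite !expr0 !expr1; split=> //; subring_tac sS.
split=> //; have -> : z ^+ k.+2 + z^-1 ^+ k.+2 =
  (z + z^-1) * (z ^+ k.+1 + z^-1 ^+ k.+1) - (z ^+ k + z^-1 ^+ k).
  by rewrite !exprS; field.
by apply: (subringB _ sS) => //; apply: (subringM _ sS).
Qed.

(** A real [x] is half of [x + x^*], a combination of the sums [z^i + z^-i]. The same averaging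
    works over the integers once 2 is inverted. *)
Lemma real_Qadj x : in_Qadj z x -> x^* = x -> in_Qadj (z + z^-1) x.
Proof.
have sS := subring_Qadj (z + z^-1).
move=> [p Dx] xc; have -> : x = (x + x^*) * ratr 2%:R^-1.
  by rewrite xc fmorphV /= ratr_nat; field.
apply: (subringM _ sS); last exact: Qadj_rat.
have -> : x + x^* = \sum_(i < size p) (ratr p`_i * (z ^+ i + z^-1 ^+ i)).
  rewrite Dx horner_coef size_map_poly rmorph_sum -big_split; apply: eq_bigr => i _ /=.
  by rewrite coef_map /= rmorphM rmorphXn /= fmorph_rat zc mulrDr.
apply: (subring_sum _ sS) => i _; apply: (subringM _ sS); first exact: Qadj_rat.
by apply: sym_pow_subring => //; apply: Qadj_gen.
Qed.

Lemma real_Zadj x : in_Zadj_half z x -> x^* = x -> in_Zadj_half (z + z^-1) x.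
Proof.
have sS := subring_Zadj (z + z^-1); have S2 := Zadj_half (z + z^-1).
move=> [p [k Dx]] xc; have -> : x = (x + x^*) / 2%:R by rewrite xc; field.
apply: (subringM _ sS) => //.
have -> : x + x^* = (\sum_(i < size p) (p`_i)%:~R * (z ^+ i + z^-1 ^+ i)) * 2%:R^-1 ^+ k.
  rewrite Dx horner_coef size_map_inj_poly //; last exact: intr_inj.
  rewrite fmorph_div rmorphXn rmorph_nat /= rmorph_sum -mulrDl -exprVn; congr (_ * _).
  rewrite -big_split; apply: eq_bigr => i _ /=.
  by rewrite coef_map /= rmorphM rmorphXn /= rmorph_int zc mulrDr.
apply: (subringM _ sS); last exact: subringX.
apply: (subring_sum _ sS) => i _; apply: (subringM _ sS); first exact: subring_int.
by apply: sym_pow_subring => //; apply: Zadj_gen.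
Qed.

Lemma Qadj_real x : in_Qadj (z + z^-1) x -> x^* = x.
Proof.
apply: (Qadj_sub _ (fun x => x^* = x)).
- by split; rewrite ?rmorph1 => // x0 y ex ey; rewrite ?rmorphB ?rmorphM /= ex ey.
- by move=> q; rewrite fmorph_rat.
- by rewrite rmorphD fmorphV /= zc invrK addrC.
Qed.

Lemma Qadj_sym x : in_Qadj (z + z^-1) x -> in_Qadj z x.
Proof.
have sS := subring_Qadj z; apply: Qadj_sub => //; first exact: Qadj_rat.
by apply: (subringD _ sS); [exact: Qadj_gen | exact: Zadj_Qadj].
Qed.

Lemma Zadj_sym x : in_Zadj_half (z + z^-1) x -> in_Zadj_half z x.
Proof.
have sS := subring_Zadj z; apply: Zadj_sub => //; first exact: Zadj_half.
by apply: (subringD _ sS) => //; exact: Zadj_gen.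
Qed.

End Conj.

Section Cyclotomic.
Variables (n : nat) (z : algC).
Hypotheses (n4 : (4 %| n)%N) (pz : n.-primitive_root z).

Lemma prim_neq0 : z != 0.
Proof.
apply/eqP => z0; have /eqP := prim_expr_order pz.
by rewrite z0 expr0n gtn_eqF ?(prim_order_gt0 pz) // eq_sym oner_eq0.
Qed.

Lemma prim_inv_Zadj : in_Zadj_half z z^-1.
Proof.
have n0 := prim_order_gt0 pz; have sZ := subring_Zadj z; have Zz := Zadj_gen z.
have -> : z^-1 = z ^+ n.-1; last by subring_tac sZ.
apply: (mulIf prim_neq0); rewrite mulVf ?prim_neq0 // -exprSr prednK //.
by rewrite (prim_expr_order pz).
Qed.

Lemma prim_half : z ^+ (n %/ 2) = -1.
Proof.
have n0 := prim_order_gt0 pz; have n2 : (n %/ 2 * 2 = n)%N by lia.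
have /eqP : (z ^+ (n %/ 2)) ^+ 2 = 1 by rewrite -exprM n2 (prim_expr_order pz).
rewrite sqrf_eq1 -(prim_order_dvd pz) => /orP[d|/eqP//].
by have := dvdn_leq _ d; lia.
Qed.

Lemma i_Zadj : in_Zadj_half z 'i.
Proof.
have sZ := subring_Zadj z; have Zz := Zadj_gen z.
have /eqP : (z ^+ (n %/ 4)) ^+ 2 = 'i ^+ 2.
  by rewrite sqrCi -exprM -prim_half; congr (z ^+ _); lia.
rewrite eqf_sqr => /orP[] /eqP e; first by rewrite -e; subring_tac sZ.
by rewrite -['i]opprK -e; subring_tac sZ.
Qed.

Lemma prim_dInt : dInt 2 z.
Proof. exact/dInt_Aint/Aint_prim_root/pz. Qed.

Let zc := conj_prim_root n z pz.
Let z0 := prim_neq0.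
Let FzV := prim_inv_Zadj.

Lemma Zadj_prim_dInt x : in_Zadj_half z x -> dInt 2 x.
Proof. by apply: Zadj_dInt; apply: prim_dInt. Qed.

(** The witnesses are [g = 1 + Re z] and [h = Im z], so the identities are [|1 + z|^2 = g^2 + h^2]
    and [4 - (2 Re z)^2 = (2 Im z)^2]. *)
Lemma two_plus_sum_sqr : exists g h, [/\ in_Qadj (z + z^-1) g /\ in_Qadj (z + z^-1) h,
  dInt 2 g /\ dInt 2 h, 2%:R + (z + z^-1) = g ^+ 2 + h ^+ 2 &
  4%:R - (z + z^-1) ^+ 2 = (2%:R * h) ^+ 2].
Proof.
have sZ := subring_Zadj z; have Zz := Zadj_gen z; have Z2 := Zadj_half z; have Zi := i_Zadj.
pose g := (2%:R + (z + z^-1)) * 2%:R^-1; pose h := - 'i * (z - z^-1) * 2%:R^-1.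
have Zg : in_Zadj_half z g by rewrite /g; subring_tac sZ.
have Zh : in_Zadj_half z h by rewrite /h; subring_tac sZ.
have i2 : 'i ^+ 2 = -1 :> algC := sqrCi _.
exists g, h; split.
- split; apply: real_Qadj; rewrite ?zc //; try exact: Zadj_Qadj.
    by rewrite /g !(rmorph_nat, fmorphV, rmorphM, rmorphD) /= zc invrK [z^-1 + z]addrC.
  by rewrite /h !(rmorph_nat, fmorphV, rmorphM, rmorphB, rmorphN) /= zc conjCi invrK; ring.
- by split; apply: Zadj_prim_dInt.
- transitivity (((2%:R + (z + z^-1)) ^+ 2 + 'i ^+ 2 * (z - z^-1) ^+ 2) / 4%:R).
    by rewrite i2; field.
  by rewrite /g /h; field.
- transitivity ('i ^+ 2 * (z - z^-1) ^+ 2); first by rewrite i2; field.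
  by rewrite /h; field.
Qed.

End Cyclotomic.

(** The shift by 2 makes 4 and 12 the base cases of the induction on [s]. *)
Definition cyclo_order n := exists s, n = (2 ^ s.+2)%N \/ n = (3 * 2 ^ s.+2)%N.

Lemma cyclo_order_dvd4 n : cyclo_order n -> (4 %| n)%N.
Proof. by case=> s; rewrite !expnS => -[] ->; lia. Qed.

Lemma prim_six n (z : algC) : (12 %| n)%N -> n.-primitive_root z ->
  (z ^+ (n %/ 6)) ^+ 2 = z ^+ (n %/ 6) - 1.
Proof.
move=> n12 pz; have n0 := prim_order_gt0 pz; set y := z ^+ _.
have y3 : y ^+ 3 = -1 by rewrite -exprM -(prim_half n z _ pz); [congr (z ^+ _)|]; lia.
have /eqP : (y + 1) * (y ^+ 2 - (y - 1)) = 0.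
  by transitivity (y ^+ 3 + 1); [ring | rewrite y3 addNr].
rewrite mulf_eq0 => /orP[]; last by rewrite subr_eq0 => /eqP.
rewrite addr_eq0 => /eqP ey; have /eqP : y ^+ 2 = 1 by rewrite ey sqrrN expr1n.
rewrite -exprM -(prim_order_dvd pz) => d.
by have := dvdn_leq _ d; lia.
Qed.

(** [1 + z] divides [1 - z^(2M)] for every [M]. With [2M = n / 2] this is 2; with [2M = n / 6] it is
    [1 - y] for a primitive sixth root of unity [y], and [y (1 - y) = 1]. *)
Lemma one_plus_prim_unit n (z : algC) : cyclo_order n -> n.-primitive_root z ->
  1 + z != 0 /\ in_Zadj_half z (1 + z)^-1.
Proof.
move=> cn pz; have n4 := cyclo_order_dvd4 n cn; have n0 := prim_order_gt0 pz.
have sZ := subring_Zadj z; have Zz := Zadj_gen z; have Z2 := Zadj_half z.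
have zV := prim_inv_Zadj n z pz.
have z1 : 1 + z != 0.
  apply/eqP => /eqP; rewrite addrC addr_eq0 => /eqP e.
  have /eqP : z ^+ 2 = 1 by rewrite e sqrrN expr1n.
  by rewrite -(prim_order_dvd pz) => d; have := dvdn_leq _ d; lia.
split=> //.
have key M : 1 - z ^+ (2 * M) != 0 -> in_Zadj_half z (1 - z ^+ (2 * M))^-1 ->
    in_Zadj_half z (1 + z)^-1.
  move=> y0 Zy.
  have Dy : 1 - z ^+ (2 * M) = (1 + z) * \sum_(i < (2 * M)%N) (- z) ^+ i.
    have := subrX1 (- z) (2 * M)%N; rewrite exprM sqrrN -exprM => E.
    transitivity (- (z ^+ (2 * M) - 1)); first ring.
    by rewrite E; ring.
  have -> : (1 + z)^-1 = (\sum_(i < (2 * M)%N) (- z) ^+ i) * (1 - z ^+ (2 * M))^-1.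
    by apply: (mulIf z1); rewrite mulVf // mulrC mulrA -Dy divff.
  apply: (subringM _ sZ) => //; apply: (subring_sum _ sZ) => i _; subring_tac sZ.
case: cn => s [] Dn.
  have Dh : (2 * 2 ^ s)%N = (n %/ 2)%N by rewrite Dn !expnS; lia.
  apply: (key (2 ^ s)%N); rewrite Dh (prim_half n z n4 pz) opprK.
    by rewrite (pnatr_eq0 _ 2).
  exact: Z2.
have Dh : (2 * 2 ^ s)%N = (n %/ 6)%N by rewrite Dn !expnS; lia.
have y2 : (z ^+ (n %/ 6)) ^+ 2 = z ^+ (n %/ 6) - 1.
  by apply: prim_six pz; rewrite Dn !expnS; lia.
have y1 : z ^+ (n %/ 6) * (1 - z ^+ (n %/ 6)) = 1 by rewrite mulrBr mulr1 -expr2 y2; ring.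
have y0 : 1 - z ^+ (n %/ 6) != 0.
  by apply/eqP => e; move: y1; rewrite e mulr0 => /eqP; rewrite eq_sym oner_eq0.
apply: (key (2 ^ s)%N); rewrite Dh //.
suff <- : z ^+ (n %/ 6) = (1 - z ^+ (n %/ 6))^-1 by subring_tac sZ.
by apply: (mulIf y0); rewrite y1 mulVf.
Qed.

(** * The Weber-type theorem by induction along the tower *)

Definition weber_property th :=
  (forall nu, in_Qadj th nu -> sqrep 2 th nu -> sq_or_twisted_sq th nu) /\
  (forall f, in_Qadj th f -> dInt 2 f -> in_Zadj_half th f).

(** The exponent [n / 2 + 1] is prime to [n] because [n / 2] is even, and it sends [z] to [- z]. *)
Lemma neg_aut n (z : algC) : (4 %| n)%N -> n.-primitive_root z ->
  exists tau : {rmorphism algC -> algC}, tau (z + z^-1) = - (z + z^-1).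
Proof.
move=> n4 pz; have n0 := prim_order_gt0 pz.
have co : coprime (n %/ 2).+1 n.
  have {2}-> : n = (n %/ 2 * 2)%N by lia.
  rewrite coprimeMr; apply/andP; split; first by rewrite coprimeSn.
  by rewrite coprimen2 /=; lia.
have [tau Htau] := Qn_aut_exists co; exists tau.
rewrite rmorphD fmorphV /= Htau ?(prim_expr_order pz) //.
by rewrite exprS (prim_half n z n4 pz) mulrN1 invrN opprD.
Qed.

Lemma weber_step n (z : algC) : cyclo_order n -> (2 * n).-primitive_root z ->
  weber_property (z ^+ 2 + (z ^+ 2)^-1) -> weber_property (z + z^-1).
Proof.
move=> cn pz; have n4 := cyclo_order_dvd4 n cn; have n8 : (4 %| 2 * n)%N by lia.
have cn2 : cyclo_order (2 * n).
  by case: cn => s [] ->; exists s.+1; rewrite [(2 ^ s.+3)%N]expnS; [left | right]; lia.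
have n0 := prim_order_gt0 pz; have z0 := prim_neq0 _ z pz.
have [tau tau_th] := neg_aut _ z n8 pz; set th := z + z^-1 in tau_th *.
have pz2 : n.-primitive_root (z ^+ 2).
  have -> : n = ((2 * n) %/ gcdn 2 (2 * n))%N by rewrite gcdnMr mulKn.
  by apply: exp_prim_root.
have [z21 Zz21] := one_plus_prim_unit _ _ cn pz2.
have [z1 Zz1] := one_plus_prim_unit _ _ cn2 pz.
(* [1 + z^2] is a unit by the result one level down, so [th] is one as well. *)
have Dth : th = z^-1 * (1 + z ^+ 2) by rewrite /th; field.
have th0 : th != 0 by rewrite Dth mulf_neq0 // invr_eq0.
have iz2 := Zadj_prim_dInt _ _ pz2 _ Zz21.
have iz1 := Zadj_prim_dInt _ _ pz _ Zz1.
have iz := prim_dInt _ z pz; have izV := Zadj_prim_dInt _ _ pz _ (prim_inv_Zadj _ z pz).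
have sI := subring_dInt 2.
have ith : dInt 2 th by rewrite /th; subring_tac sI.
have ithV : dInt 2 th^-1 by rewrite Dth invfM invrK; subring_tac sI.
have -> : z ^+ 2 + (z ^+ 2)^-1 = th ^+ 2 - 2%:R by rewrite /th; field.
(* Applied to [z], the identities make [2 + th] a sum of two squares. Applied to [z^2], they make
   [th^2 = 2 + th'] one, and give [4 - th'^2 = (2 h)^2]. *)
have [g' [h' [[Fg' Fh'] [ig' ih'] Dgh' Dh']]] := two_plus_sum_sqr _ _ n8 pz.
have [g [h [[Fg Fh] [ig ih] Dgh Dh]]] := two_plus_sum_sqr _ _ n4 pz2.
have Eth : z ^+ 2 + (z ^+ 2)^-1 = th ^+ 2 - 2%:R by rewrite /th; field.
rewrite -/th in Fg' Fh' Dgh' Dh'; rewrite Eth in Fg Fh Dgh Dh.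
have Dpi : 2%:R + th = (1 + z) ^+ 2 / z by rewrite /th; field.
have pi0 : 2%:R + th != 0.
  by rewrite Dpi mulf_neq0 ?expf_neq0 // invr_eq0.
have ipi : dInt 2 (2%:R + th)^-1.
  by rewrite Dpi invf_div -exprVn; subring_tac sI.
case=> [W I]; split; last exact: (quad_integral th tau).
apply: (quad_square th tau tau_th th0 ithV [:: g; h] (2%:R * h)) => //.
- by move=> x; rewrite !inE => /orP[] /eqP->.
- by rewrite !big_cons big_nil addr0 -Dgh; ring.
- exists [:: g'; h']; last by rewrite !big_cons big_nil addr0.
  by move=> x; rewrite !inE => /orP[] /eqP->; split=> //; subring_tac sI.
- by have sQ := subring_Qadj (th ^+ 2 - 2%:R); subring_tac sQ.
- by rewrite -Dh; ring.
Qed.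

Lemma weber n (z : algC) : cyclo_order n -> n.-primitive_root z -> weber_property (z + z^-1).
Proof.
case=> s Dn; elim: s n z Dn => [|s IH] n z Dn pz; last first.
  pose m := (n %/ 2)%N.
  have Dm : m = (2 ^ s.+2)%N \/ m = (3 * 2 ^ s.+2)%N.
    by rewrite /m; case: Dn => ->; [left | right]; rewrite [(2 ^ s.+3)%N]expnS; lia.
  have D2m : n = (2 * m)%N by rewrite /m; case: Dn => ->; rewrite [(2 ^ s.+3)%N]expnS; lia.
  rewrite D2m in pz.
  apply: (weber_step m z _ pz); first by exists s.
  apply: IH Dm _; have -> : m = ((2 * m) %/ gcdn 2 (2 * m))%N by rewrite gcdnMr mulKn.
  by apply: exp_prim_root.
have z0 := prim_neq0 _ z pz.
case: Dn => /= Dn; rewrite Dn in pz.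
  have th0 : z + z^-1 = 0.
    have := prim_half 4 z isT pz; rewrite (_ : 4 %/ 2 = 2)%N // => z2.
    by apply: (mulIf z0); rewrite mulrDl mulVf // -expr2 z2 mul0r addNr.
  split=> [nu _|f Ff iF]; first exact: weber_Q.
  by apply: Crat_dInt2 => //; apply: Qadj_Crat Ff; rewrite th0 rpred0.
have th_sq : (z + z^-1) ^+ 2 = 3%:R.
  (* Here [z^4 = z^2 - 1], so [z^4 + 2 z^2 + 1 = 3 z^2]. *)
  have := prim_six 12 z isT pz; rewrite (_ : 12 %/ 6 = 2)%N // => z4.
  apply: (mulIf (expf_neq0 2 z0)); transitivity ((z ^+ 2) ^+ 2 + 2%:R * z ^+ 2 + 1); first by field.
  by rewrite z4; ring.
have [tau tau_th] := neg_aut 12 z isT pz.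
split=> [nu|f]; first exact: weber_sqrt3 tau_th th_sq nu.
exact: sqrt3_integral tau_th th_sq f.
Qed.

(** * Unitary matrices and quaternions *)

Lemma sqr_i : 'i * 'i = -1 :> algC. Proof. by rewrite -expr2 sqrCi. Qed.

Lemma conj_Re (x : algC) : ('Re x)^* = 'Re x. Proof. exact: conj_Creal (Creal_Re x). Qed.
Lemma conj_Im (x : algC) : ('Im x)^* = 'Im x. Proof. exact: conj_Creal (Creal_Im x). Qed.

Lemma m2_eta (A : 'M[algC]_2) : A = m2 (A 0 0) (A 0 1) (A 1 0) (A 1 1).
Proof.
apply/matrixP => i j; rewrite mxE.
by case: i => [[|[|]]] // ?; case: j => [[|[|]]] // ? /=; congr (A _ _); apply: val_inj.
Qed.

Lemma m2_inj a b c d a' b' c' d' : m2 a b c d = m2 a' b' c' d' ->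
  [/\ a = a', b = b', c = c' & d = d'].
Proof.
move=> /matrixP e; split; [have := e 0 0 | have := e 0 1 | have := e 1 0 | have := e 1 1];
  by rewrite !mxE.
Qed.

Lemma m2_mul a b c d a' b' c' d' : m2 a b c d *m m2 a' b' c' d' =
  m2 (a * a' + b * c') (a * b' + b * d') (c * a' + d * c') (c * b' + d * d').
Proof.
apply/matrixP => i j; rewrite !mxE !big_ord_recl big_ord0 !mxE /= addr0.
by case: i => [[|[|]]] // ?; case: j => [[|[|]]].
Qed.

Lemma m2_scale k a b c d : k *: m2 a b c d = m2 (k * a) (k * b) (k * c) (k * d).
Proof.
apply/matrixP => i j; rewrite !mxE.
by case: i => [[|[|]]] // ?; case: j => [[|[|]]].
Qed.

Lemma det2 (A : 'M[algC]_2) : \det A = A 0 0 * A 1 1 - A 0 1 * A 1 0.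
Proof.
rewrite (expand_det_row _ 0) !big_ord_recl big_ord0 addr0 /cofactor !det_mx11 !mxE /=.
rewrite addn0 addn1 expr0 expr1 mul1r mulN1r mulrN.
by congr (_ * A _ _ - A _ _ * A _ _); apply: val_inj.
Qed.

Lemma m2_det a b c d : \det (m2 a b c d) = a * d - b * c.
Proof. by rewrite det2 !mxE. Qed.

Lemma m2_conj a b c d : mconj (m2 a b c d) = m2 a^* c^* b^* d^*.
Proof.
apply/matrixP => i j; rewrite !mxE.
by case: i => [[|[|]]] // ?; case: j => [[|[|]]].
Qed.

Lemma m2_1 : 1%:M = m2 1 0 0 1.
Proof.
apply/matrixP => i j; rewrite !mxE.
by case: i => [[|[|]]] // ?; case: j => [[|[|]]].
Qed.

(** The matrix that [phi_rel] attaches to [q] through [qr = r], [qi = - u], [qj = - t], [qk = - s];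
    with these signs it is multiplicative. *)
Definition qmat (q : quat) : 'M[algC]_2 :=
  m2 (qr q - qk q * 'i) (- qj q - qi q * 'i) (qj q - qi q * 'i) (qr q + qk q * 'i).

Definition qnorm (q : quat) : algC := qr q ^+ 2 + qi q ^+ 2 + qj q ^+ 2 + qk q ^+ 2.

Definition qconj (q : quat) : quat := Quat (qr q) (- qi q) (- qj q) (- qk q).

Lemma quat_eta q : q = Quat (qr q) (qi q) (qj q) (qk q). Proof. by case: q. Qed.

Lemma qmatM p q : qmat (qmul p q) = qmat p *m qmat q.
Proof.
case: p => pr pi pj pk; case: q => r i j k; rewrite /qmat /qmul m2_mul /=.
have E (x : algC) : x * ('i * 'i) = - x by rewrite sqr_i mulrN1.
congr m2.
- transitivity (pr * r - pj * j + (pi * i) * ('i * 'i) + (pk * k) * ('i * 'i)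
    + (pj * i - pi * j - pr * k - pk * r) * 'i);
    [rewrite !E; ring | ring].
- transitivity (- pr * j - pj * r + (pk * i) * ('i * 'i) - (pi * k) * ('i * 'i)
    + (pk * j - pj * k - pr * i - pi * r) * 'i);
    [rewrite !E; ring | ring].
- transitivity (pj * r + pr * j + (pi * k) * ('i * 'i) - (pk * i) * ('i * 'i)
    + (pk * j - pj * k - pi * r - pr * i) * 'i);
    [rewrite !E; ring | ring].
- transitivity (pr * r - pj * j + (pi * i) * ('i * 'i) + (pk * k) * ('i * 'i)
    + (pi * j - pj * i + pr * k + pk * r) * 'i);
    [rewrite !E; ring | ring].
Qed.

Lemma qmatZ c q : qmat (qscale c q) = c *: qmat q.
Proof. by rewrite /qmat /qscale m2_scale /=; congr m2; ring. Qed.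

Lemma qmat_inj : injective qmat.
Proof.
have half (x y : algC) : x + x = y + y -> x = y.
  by move=> e; apply: (mulfI two_neq0); rewrite !mulr_natl !mulr2n.
have halfi (x y : algC) : x * 'i + x * 'i = y * 'i + y * 'i -> x = y.
  by move/half; apply: mulIf; apply: neq0Ci.
move=> [r i j k] [r' i' j' k'] /m2_inj /= [e1 e2 e3 e4]; congr Quat.
- apply: half.
  transitivity ((r - k * 'i) + (r + k * 'i)); first ring.
  by rewrite e1 e4; ring.
- apply: halfi; apply: oppr_inj.
  transitivity ((- j - i * 'i) + (j - i * 'i)); first ring.
  by rewrite e2 e3; ring.
- apply: half.
  transitivity ((j - i * 'i) - (- j - i * 'i)); first ring.
  by rewrite e2 e3; ring.
- apply: halfi.
  transitivity ((r + k * 'i) - (r - k * 'i)); first ring.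
  by rewrite e1 e4; ring.
Qed.

Lemma qmat_det q : \det (qmat q) = qnorm q.
Proof.
rewrite m2_det /qnorm.
transitivity (qr q ^+ 2 + qj q ^+ 2 - (qk q ^+ 2 + qi q ^+ 2) * ('i * 'i)); first ring.
by rewrite sqr_i; ring.
Qed.

Lemma qnormM p q : qnorm (qmul p q) = qnorm p * qnorm q.
Proof. by rewrite /qnorm /qmul /=; ring. Qed.

Lemma qmul_conj q : qmul q (qconj q) = Quat (qnorm q) 0 0 0.
Proof. by rewrite /qmul /qconj /qnorm /=; congr Quat; ring. Qed.

Lemma qmul_conjl q : qmul (qconj q) q = Quat (qnorm q) 0 0 0.
Proof. by rewrite /qmul /qconj /qnorm /=; congr Quat; ring. Qed.

Lemma qmul_scaler c p q : qmul p (qscale c q) = qscale c (qmul p q).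
Proof. by rewrite /qmul /qscale /=; congr Quat; ring. Qed.

Lemma qmul_scalel c p q : qmul (qscale c p) q = qscale c (qmul p q).
Proof. by rewrite /qmul /qscale /=; congr Quat; ring. Qed.

Definition real_quat q := [/\ (qr q)^* = qr q, (qi q)^* = qi q, (qj q)^* = qj q & (qk q)^* = qk q].

Lemma qmat_mconj q : real_quat q -> mconj (qmat q) = qmat (qconj q).
Proof.
case=> er ei ej ek; rewrite m2_conj /qmat /qconj /=.
by congr m2; rewrite !(rmorphD, rmorphM, rmorphN) /= conjCi ?er ?ei ?ej ?ek; ring.
Qed.

(** Each entry of the second row is multiplied by [|A 0 0|^2 + |A 0 1|^2 = 1]; orthogonality of the
    rows then leaves the determinant times a conjugate entry of the first row. *)
Lemma unitary2_form (A : 'M[algC]_2) : A *m mconj A = 1%:M ->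
  \det A * (\det A)^* = 1 /\
  A = m2 (A 0 0) (A 0 1) (- \det A * (A 0 1)^*) (\det A * (A 0 0)^*).
Proof.
move=> uA; split.
  have := congr1 (@determinant _ _) uA; rewrite det_mulmx det1 /mconj det_tr.
  by rewrite det_map_mx.
move: uA; rewrite {1 2}[A]m2_eta m2_conj m2_mul m2_1 => /m2_inj[e1 _ e3 _].
rewrite {1}[A]m2_eta det2; congr m2.
  transitivity (A 1 0 * (A 0 0 * (A 0 0)^* + A 0 1 * (A 0 1)^*)); first by rewrite e1 mulr1.
  have -> : A 1 0 * (A 0 0 * (A 0 0)^* + A 0 1 * (A 0 1)^*) =
   A 0 0 * (A 1 0 * (A 0 0)^* + A 1 1 * (A 0 1)^*)
     + - (A 0 0 * A 1 1 - A 0 1 * A 1 0) * (A 0 1)^* by ring.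
  by rewrite e3 mulr0 add0r.
transitivity (A 1 1 * (A 0 0 * (A 0 0)^* + A 0 1 * (A 0 1)^*)); first by rewrite e1 mulr1.
have -> : A 1 1 * (A 0 0 * (A 0 0)^* + A 0 1 * (A 0 1)^*) =
  A 0 1 * (A 1 0 * (A 0 0)^* + A 1 1 * (A 0 1)^*)
    + (A 0 0 * A 1 1 - A 0 1 * A 1 0) * (A 0 0)^* by ring.
by rewrite e3 mulr0 add0r.
Qed.

Lemma phi_relP z A q : phi_rel z A q <-> exists beta,
  [/\ inK z beta, beta != 0, \det A = beta^* / beta, inH z q & beta *: A = qmat q].
Proof.
split.
  case=> b [Kb b0 Db [r [s [t [u [[Fr Fs] [Ft Fu] DA ->]]]]]].
  have sF := subring_Qadj (z + z^-1).
  exists b; split=> //; first by split=> //=; subring_tac sF.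
  by rewrite DA /qmat /=; congr m2; ring.
case=> b [Kb b0 Db [Fr Fi Fj Fk] DA]; exists b; split=> //.
have sF := subring_Qadj (z + z^-1).
exists (qr q), (- qk q), (- qj q), (- qi q); split; try by split=> //; subring_tac sF.
  by rewrite DA /qmat; congr m2; ring.
by rewrite !opprK -quat_eta.
Qed.

(** * The map from unitary matrices to quaternion classes, and its image *)

Section Main.
Variables (n : nat) (z : algC).
Hypotheses (cn : cyclo_order n) (pz : n.-primitive_root z).
Let n4 := cyclo_order_dvd4 n cn.
Let zc := conj_prim_root n z pz.
Let z0 := prim_neq0 n z pz.
Let ZzV := prim_inv_Zadj n z pz.
Let Zi := i_Zadj n z n4 pz.
Let Ki := Zadj_Qadj z _ Zi.
Let sK := subring_Qadj z.
Let sR := subring_Zadj z.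
Let sF := subring_Qadj (z + z^-1).
Let sI := subring_dInt 2.
Let i2 : dInt 2 2%:R^-1. Proof. exact: dInt_inv. Qed.
Let R2 := Zadj_half z.
Let K2 := Zadj_Qadj z _ R2.

Lemma inF_inK x : inF z x <-> inK z x /\ x^* = x.
Proof.
split=> [Fx|[Kx xc]]; last exact: real_Qadj.
by split; [exact: Qadj_sym | exact: Qadj_real Fx].
Qed.

Lemma inRr_inR x : inRr z x <-> inR z x /\ x^* = x.
Proof.
split=> [Rx|[Kx xc]]; last exact: real_Zadj.
by split; [exact: Zadj_sym | exact: Qadj_real (Zadj_Qadj _ _ Rx)].
Qed.

Lemma inR_Re_Im x : inR z x -> inRr z ('Re x) /\ inRr z ('Im x).
Proof.
move=> Rx; have Rxc : in_Zadj_half z x^* by exact: conj_Zadj.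
split; apply/inRr_inR; rewrite ?conj_Re ?conj_Im; split=> //.
  by rewrite ReE /inR; subring_tac sR.
by rewrite ImE /inR; subring_tac sR.
Qed.

(** Real and imaginary parts reduce this to [F], because [R_n] contains ['i] and the inverse of
    2. *)
Lemma inK_integral x : inK z x -> dInt 2 x -> inR z x.
Proof.
move=> Kx ix; have [_ int_F] := weber n z cn pz.
have Kxc : in_Qadj z x^* by exact: conj_Qadj.
have ixc := dInt_conj 2 x ix; have ii := Zadj_prim_dInt n z pz _ Zi.
have RRe : in_Zadj_half z ('Re x).
  apply: Zadj_sym ZzV _ _; apply: int_F; last by rewrite ReE; subring_tac sI.
  by apply/inF_inK; rewrite conj_Re; split=> //; rewrite ReE /inK; subring_tac sK.
have RIm : in_Zadj_half z ('Im x).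
  apply: Zadj_sym ZzV _ _; apply: int_F; last by rewrite ImE; subring_tac sI.
  by apply/inF_inK; rewrite conj_Im; split=> //; rewrite ImE /inK; subring_tac sK.
by rewrite /inR [x]Crect; apply: (subringD _ sR) => //; apply: (subringM _ sR).
Qed.

Lemma inH_real q : inH z q -> real_quat q.
Proof. by case=> /inF_inK[_ ?] /inF_inK[_ ?] /inF_inK[_ ?] /inF_inK[_ ?]. Qed.

(** With 2 invertible, the generator [(1+i+j+k)/2] adds nothing to the span of [1, i, j, k]. *)
Lemma inMP q : inM z q <-> [/\ inRr z (qr q), inRr z (qi q), inRr z (qj q) & inRr z (qk q)].
Proof.
have sRr := subring_Zadj (z + z^-1); have Rr2 := Zadj_half (z + z^-1).
split=> [[a [b [c [d [Ra Rb Rc Rd ->]]]]]|[Rr Ri Rj Rk]].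
  by rewrite /inRr in Ra Rb Rc Rd *; split=> /=; subring_tac sRr.
exists (qr q - qk q), (qi q - qk q), (qj q - qk q), (2%:R * qk q).
rewrite /inRr in Rr Ri Rj Rk *; split; try by subring_tac sRr.
by rewrite {1}[q]quat_eta; congr Quat; field.
Qed.

Lemma twist_norm : 2%:R + (z + z^-1) = (1 + z) * (1 + z)^*.
Proof. by rewrite rmorphD rmorph1 /= zc; field. Qed.

(** The usual solution [b = 1 + d^*] need not be a unit, but [b b^* = d b^2] satisfies the Weber
    condition. Dividing [b] by the resulting real [f] keeps the equation and makes [b / f] a unit.
    For [d = -1], where [b] vanishes, ['i] serves. *)
Lemma hilbert90_unit d : inR z d -> d * d^* = 1 ->
  exists b, [/\ inR z b, inR z b^-1, b != 0 & d = b^* / b].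
Proof.
move=> Rd dd; have Rdc : in_Zadj_half z d^* by exact: conj_Zadj.
have [dN1|dN1] := eqVneq d (-1).
  have i0 : 'i != 0 :> algC by exact: neq0Ci.
  exists 'i; split=> //; first by rewrite invCi /inR; subring_tac sR.
  by rewrite conjCi mulNr divff.
pose b := 1 + d^*; pose nu := b * b^*.
have bc : b^* = d * b by rewrite /b rmorphD rmorph1 /= conjCK mulrDr mulr1 dd addrC.
have b0 : b != 0.
  apply: contra_neq dN1 => b0; rewrite -[d]conjCK; move/eqP: b0.
  by rewrite /b addrC addr_eq0 => /eqP->; rewrite rmorphN rmorph1.
have d0 : d != 0 by apply: contra_eq_neq dd => ->; rewrite mul0r eq_sym oner_eq0.
have dV : d^-1 = d^* by apply: (mulIf d0); rewrite mulVf // mulrC dd.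
have Dnu : nu = d * b ^+ 2 by rewrite /nu bc; ring.
have nu0 : nu != 0 by rewrite Dnu mulf_neq0 ?expf_neq0.
have Rb : in_Zadj_half z b by rewrite /b; subring_tac sR.
have [RRe RIm] := inR_Re_Im b Rb.
have id := Zadj_prim_dInt n z pz _ Rd; have idV := Zadj_prim_dInt n z pz _ Rdc.
have ii := Zadj_prim_dInt n z pz _ Zi.
(* Since [b^* = d b], the real and imaginary parts of [b] are [b (1 + d) / 2] and
   ['i b (d - 1) / 2]; dividing their squares by [d b^2] cancels [b]. *)
have Snu : sqrep 2 (z + z^-1) nu.
  exists [:: 'Re b; 'Im b]; last first.
    by rewrite !big_cons big_nil addr0 /nu -normCK normC2_Re_Im.
  move=> x; rewrite !inE => /orP[] /eqP->; split; try exact: Zadj_Qadj.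
    have -> : 'Re b ^+ 2 / nu = ((1 + d) * 2%:R^-1) ^+ 2 * d^*.
      by rewrite ReE bc Dnu -dV; field; rewrite d0 b0.
    by subring_tac sI.
  have -> : 'Im b ^+ 2 / nu = ('i * (d - 1) * 2%:R^-1) ^+ 2 * d^*.
    by rewrite ImE bc Dnu -dV; field; rewrite d0 b0.
  by subring_tac sI.
have Fnu : in_Qadj (z + z^-1) nu.
  apply/inF_inK; split; last by rewrite /nu rmorphM /= conjCK mulrC.
  by apply: Zadj_Qadj; rewrite Dnu; subring_tac sR.
have [W _] := weber n z cn pz; have [f Ff Df] := W _ Fnu Snu.
have [z1 Rz1] := one_plus_prim_unit n z cn pz.
have [Kf fc] := (inF_inK f).1 Ff.
have f0 : f != 0 by apply: contra_neq nu0 => f0; case: Df => ->; rewrite f0 expr0n ?mulr0.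
have Kb : inK z (b / f).
  by apply: (subringM _ sK); [exact: Zadj_Qadj | exact: QadjV].
have z1c0 : (1 + z)^* != 0 by rewrite fmorph_eq0.
have Rz1c : in_Zadj_half z ((1 + z)^-1)^* by exact: conj_Zadj.
have Rz1' : in_Zadj_half z (1 + z) by have := Zadj_gen z => ?; subring_tac sR.
have Rz1c' : in_Zadj_half z (1 + z)^* by exact: conj_Zadj.
(* [(b / f) ^+ 2] is [d^-1] or [d^-1 (2 + th)] *)
have [e [Re ReV e0 De]] : exists e,
    [/\ in_Zadj_half z e, in_Zadj_half z e^-1, e != 0 & (b / f) ^+ 2 = e].
  case: Df => Df.
    exists d^*; split=> //; first by rewrite -dV invrK.
      by rewrite -dV invr_eq0.
    by rewrite expr_div_n -Df Dnu -dV; field; rewrite d0 b0.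
  exists (d^* * ((1 + z) * (1 + z)^*)); split; first by subring_tac sR.
  - by rewrite !invfM -dV invrK -fmorphV; subring_tac sR.
  - by rewrite -dV !mulf_neq0 // invr_eq0.
  - rewrite -twist_norm -dV; apply: (mulIf (expf_neq0 2 f0)).
    by rewrite expr_div_n mulfVK ?expf_neq0 // -[RHS]mulrA -Df Dnu mulKf.
have bf0 : b / f != 0 by rewrite mulf_neq0 // invr_eq0.
exists (b / f); split=> //.
- apply: inK_integral => //; apply: dInt_sqrt; rewrite De.
  exact: Zadj_prim_dInt pz _ Re.
- apply: inK_integral; first exact: QadjV.
  by apply: dInt_sqrt; rewrite exprVn De; apply: Zadj_prim_dInt pz _ ReV.
- by rewrite fmorph_div /= fc bc; field; rewrite f0.
Qed.

Lemma inR_det (A : 'M[algC]_2) : (forall i j, inR z (A i j)) -> inR z (\det A).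
Proof.
move=> RA; rewrite det2.
by apply: (subringB _ sR); apply: (subringM _ sR); apply: RA.
Qed.

Lemma phi_unit A : unitaryR z A -> exists q, phi_rel z A q /\ inMunit z q.
Proof.
case=> RA uA; have [dd DA] := unitary2_form A uA; have Rd := inR_det A RA.
(* Choosing [beta] to be a unit of [R_n] keeps [beta A] over [R_n] and makes its reduced norm
   [beta beta^*] invertible. *)
have [b [Rb RbV b0 Db]] := hilbert90_unit _ Rd dd.
pose x := b * A 0 0; pose y := b * A 0 1.
have Rx : inR z x by apply: (subringM _ sR) => //; apply: RA.
have Ry : inR z y by apply: (subringM _ sR) => //; apply: RA.
have [xRe xIm] := inR_Re_Im x Rx; have [yRe yIm] := inR_Re_Im y Ry.
pose q := Quat ('Re x) (- 'Im y) (- 'Re y) (- 'Im x).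
have sRr := subring_Zadj (z + z^-1).
have Mq : inM z q by apply/inMP; split=> //=; apply: (subringN _ sRr).
have Dq : b *: A = qmat q.
  rewrite DA m2_scale /qmat /= !mulNr !opprK -!(mulrC 'i).
  have xE : x^* = 'Re x - 'i * 'Im x.
    by rewrite {1}[x]Crect rmorphD rmorphM /= conjCi conj_Re conj_Im mulNr.
  have yE : y^* = 'Re y - 'i * 'Im y.
    by rewrite {1}[y]Crect rmorphD rmorphM /= conjCi conj_Re conj_Im mulNr.
  have bd : b * \det A = b^* by rewrite Db mulrC mulfVK.
  congr m2; rewrite ?opprK.
  - by rewrite -Crect.
  - by rewrite -Crect.
  - by rewrite mulrN mulrA bd -rmorphM /= -/y yE; ring.
  - by rewrite mulrA bd -rmorphM /= -/x xE.
exists q; split.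
  apply/phi_relP; exists b; split=> //; first exact: Zadj_Qadj.
  by have /inMP[? ? ? ?] := Mq; split; apply: Zadj_Qadj.
have Nq : qnorm q = b * b^* by rewrite -qmat_det -Dq detZ Db; field.
have N0 : qnorm q != 0 by rewrite Nq mulf_neq0 // fmorph_eq0.
have RN : inRr z (qnorm q)^-1.
  apply/inRr_inR; split; last by rewrite Nq fmorphV rmorphM /= conjCK mulrC.
  rewrite Nq invfM -fmorphV; apply: (subringM _ sR) => //; exact: conj_Zadj.
split=> //; exists (qscale (qnorm q)^-1 (qconj q)); split.
- have /inMP[? ? ? ?] := Mq; apply/inMP; split=> /=; apply: (subringM _ sRr) => //;
    exact: (subringN _ sRr).
- by rewrite qmul_scaler qmul_conj /qscale /= !mulr0 mulVf.
- by rewrite qmul_scalel qmul_conjl /qscale /= !mulr0 mulVf.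
Qed.

(** The ratio [b' l / b] is fixed by conjugation because [det (l A) = l^2 det A]. The case [l = 1]
    gives independence of [beta]. *)
Lemma qequiv_scal A A' q q' l : inK z l -> l * l^* = 1 -> A' = l *: A ->
  phi_rel z A q -> phi_rel z A' q' -> qequiv z q q'.
Proof.
move=> Kl ll DA /phi_relP[b [Kb b0 Db Hq Dq]] /phi_relP[b' [Kb' b'0 Db' Hq' Dq']].
have l0 : l != 0 by apply: contra_eq_neq ll => ->; rewrite mul0r eq_sym oner_eq0.
have lc : l^* = l^-1 by apply: (mulfI l0); rewrite ll mulfV.
exists (b' * l / b); split.
- apply/inF_inK; split.
    by apply: (subringM _ sK); [exact: (subringM _ sK) | exact: QadjV].
  have b'c : b'^* = l ^+ 2 * (b^* / b) * b'.
    by apply: (mulIf (invr_neq0 b'0)); rewrite -Db' mulfK // DA detZ Db.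
  have bc0 : b^* != 0 by rewrite fmorph_eq0.
  rewrite fmorph_div rmorphM /= b'c lc; set c := b^* in bc0 *; clearbody c.
  by field; rewrite b0 bc0 l0.
- by rewrite !mulf_neq0 // invr_eq0.
- apply: qmat_inj; rewrite qmatZ -Dq -Dq' DA !scalerA; congr (_ *: _).
  by rewrite mulfVK.
Qed.

Lemma phi_mul A B q q' q'' : phi_rel z A q -> phi_rel z B q' -> phi_rel z (A *m B) q'' ->
  qequiv z (qmul q q') q''.
Proof.
move=> /phi_relP[b [Kb b0 Db Hq Dq]] /phi_relP[b' [Kb' b'0 Db' Hq' Dq']].
move=> /phi_relP[b'' [Kb'' b''0 Db'' Hq'' Dq'']].
exists (b'' / (b * b')); split.
- apply/inF_inK; split.
    by apply: (subringM _ sK) => //; apply: QadjV; apply: (subringM _ sK).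
  have b''c : b''^* = (b^* / b) * (b'^* / b') * b''.
    by apply: (mulIf (invr_neq0 b''0)); rewrite -Db'' mulfK // det_mulmx Db Db'.
  have bc0 : b^* != 0 by rewrite fmorph_eq0.
  have b'c0 : b'^* != 0 by rewrite fmorph_eq0.
  rewrite fmorph_div rmorphM /= b''c; set c := b^* in bc0 *; set c' := b'^* in b'c0 *.
  by clearbody c c'; field; rewrite b0 b'0 bc0 b'c0.
- by rewrite mulf_neq0 // invr_eq0 mulf_neq0.
- apply: qmat_inj; rewrite qmatZ qmatM -Dq -Dq' -Dq'' -scalemxAl -scalemxAr !scalerA.
  by congr (_ *: _); field; rewrite b0 b'0.
Qed.

(** The proportionality factor [l] is a diagonal entry of [A' *m mconj A], hence in [R_n]; unitarity
    of [A'] gives [l l^* = 1]. *)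
Lemma phi_inj A A' q q' : unitaryR z A -> unitaryR z A' ->
  phi_rel z A q -> phi_rel z A' q' -> qequiv z q q' -> scal_equiv z A A'.
Proof.
move=> [RA uA] [RA' uA'] /phi_relP[b [Kb b0 Db Hq Dq]] /phi_relP[b' [Kb' b'0 Db' Hq' Dq']].
case=> c [Fc c0 Dc]; pose l := c * b / b'.
have DA : A' = l *: A.
  apply: (scalerI b'0); rewrite Dq' Dc qmatZ -Dq !scalerA; congr (_ *: _).
  by rewrite /l; field.
have lA : A' *m mconj A = l%:M by rewrite DA -scalemxAl uA scalemx1.
exists l; split=> //.
  have -> : l = (A' *m mconj A) 0 0 by rewrite lA mxE.
  rewrite !mxE; apply: (subring_sum _ sR) => k _; rewrite !mxE.
  by apply: (subringM _ sR); [apply: RA' | apply: conj_Zadj => //; apply: RA].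
have : A' *m mconj A' = (l * l^*)%:M.
  have -> : mconj A' = l^* *: mconj A.
    by rewrite DA; apply/matrixP => i j; rewrite !mxE rmorphM.
  by rewrite -scalemxAr lA scale_scalar_mx mulrC.
by rewrite uA' => /matrixP/(_ 0 0); rewrite !mxE.
Qed.

Lemma phi_onto m : inMunit z m -> exists A, unitaryR z A /\ phi_rel z A m.
Proof.
case=> Mm [m' [Mm' mm' _]].
have /inMP[Rr Ri Rj Rk] := Mm; have /inMP[Rr' Ri' Rj' Rk'] := Mm'.
have Hm : inH z m by split; apply: Zadj_Qadj.
have sRr := subring_Zadj (z + z^-1).
have NN : qnorm m * qnorm m' = 1 by rewrite -qnormM mm' /qnorm /=; ring.
have RN : in_Zadj_half (z + z^-1) (qnorm m) by rewrite /qnorm; subring_tac sRr.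
have RN' : in_Zadj_half (z + z^-1) (qnorm m') by rewrite /qnorm; subring_tac sRr.
have N0 : qnorm m != 0 by apply: contra_eq_neq NN => ->; rewrite mul0r eq_sym oner_eq0.
have NV : (qnorm m)^-1 = qnorm m' by apply: (mulfI N0); rewrite mulfV.
have Rr_int x : in_Zadj_half (z + z^-1) x -> dInt 2 x.
  by move=> Rx; apply: Zadj_prim_dInt pz _ _; apply: Zadj_sym.
(* The norm of [m] is a unit with inverse the norm of [m'], so every quotient is integral away from
   2. *)
have SN : sqrep 2 (z + z^-1) (qnorm m).
  exists [:: qr m; qi m; qj m; qk m]; last by rewrite !big_cons big_nil /qnorm; ring.
  move=> x; rewrite !inE NV => /or4P[] /eqP->; (split; first exact: Zadj_Qadj);
    by apply: Rr_int; apply: (subringM _ sRr) => //; apply: (subringX _ sRr).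
have [W _] := weber n z cn pz.
have [f Ff Df] := W _ (Zadj_Qadj _ _ RN) SN.
have [z1 Rz1] := one_plus_prim_unit n z cn pz.
have [Kf fc] := (inF_inK f).1 Ff.
have Rz1' : in_Zadj_half z (1 + z) by have := Zadj_gen z => ?; subring_tac sR.
(* [g] is [f] or [f (1 + z)], according to the two alternatives. *)
have [g [Kg ig Dg]] : exists g, [/\ inK z g, dInt 2 g & qnorm m = g * g^*].
  case: Df => Df.
    exists f; split=> //; last by rewrite fc Df expr2.
    by apply: dInt_sqrt; rewrite -Df; apply: Rr_int.
  exists (f * (1 + z)); split.
  - by apply: (subringM _ sK) => //; apply: Zadj_Qadj.
  - apply: (subringM _ sI); last exact: Zadj_prim_dInt pz _ Rz1'.
    apply: dInt_sqrt; have -> : f ^+ 2 = qnorm m * ((1 + z)^-1 * ((1 + z)^-1)^*).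
      by rewrite Df twist_norm fmorphV /= -invfM mulrC mulKf // mulf_neq0 // fmorph_eq0.
    apply: (subringM _ sI); first exact: Rr_int.
    by apply: (Zadj_prim_dInt n z pz); apply: (subringM _ sR) => //; apply: conj_Zadj.
  - by rewrite rmorphM /= fc Df twist_norm; ring.
have /andP[g0 gc0] : (g != 0) && (g^* != 0) by rewrite -negb_or -mulf_eq0 -Dg.
have Rg := inK_integral g Kg ig.
have RgV : inR z g^-1.
  have -> : g^-1 = g^* * qnorm m' by rewrite -NV Dg invfM mulrCA divff // mulr1.
  by apply: (subringM _ sR); [exact: conj_Zadj | exact: Zadj_sym].
have Rm x : inRr z x -> in_Zadj_half z x by move=> Rx; apply: Zadj_sym.
exists (g^-1 *: qmat m); split; last first.
  apply/phi_relP; exists g; split=> //; last by rewrite scalerA divff // scale1r.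
  by rewrite detZ qmat_det Dg; field.
split.
  move=> i j; rewrite mxE; apply: (subringM _ sR) => //; rewrite mxE.
  have {}Rr := Rm _ Rr; have {}Ri := Rm _ Ri; have {}Rj := Rm _ Rj; have {}Rk := Rm _ Rk.
  by do 2 case: ifP => _; subring_tac sR.
have -> : mconj (g^-1 *: qmat m) = g^-1^* *: qmat (qconj m).
  by rewrite -(qmat_mconj _ (inH_real _ Hm)); apply/matrixP => i j; rewrite !mxE rmorphM.
rewrite -scalemxAl -scalemxAr scalerA -qmatM qmul_conj.
have -> : Quat (qnorm m) 0 0 0 = qscale (qnorm m) qone by rewrite /qscale /= mulr1 !mulr0.
rewrite qmatZ scalerA Dg fmorphV /=.
have -> : qmat qone = 1%:M by rewrite m2_1 /qmat /=; congr m2; ring.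
have -> : g^-1 / g^* * (g * g^*) = 1 by rewrite -invfM mulVf // mulf_neq0.
by rewrite scale1r.
Qed.

Lemma qequiv_refl q : qequiv z q q.
Proof.
exists 1; split; [exact: subring1 sF | exact: oner_neq0 |].
by rewrite {1}[q]quat_eta /qscale !mul1r.
Qed.

End Main.

Theorem theorem3p25 (n : nat) (z : algC) :
  (exists s : nat, n = (2 ^ s)%N \/ n = (3 * 2 ^ s)%N) -> (8 <= n)%N ->
  n.-primitive_root z ->
  [/\ (* phi_n is defined on every element of U_2(R_n), and well defined on
         PU_2(R_n) with values in H_n^x / F_n^x *)
      (forall A, unitaryR z A -> exists q, phi_rel z A q) /\
      (forall A A' q q', unitaryR z A -> unitaryR z A' -> scal_equiv z A A' ->
         phi_rel z A q -> phi_rel z A' q' -> qequiv z q q'),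
      (* group homomorphism *)
      (forall A B q q' q'', unitaryR z A -> unitaryR z B ->
         phi_rel z A q -> phi_rel z B q' -> phi_rel z (A *m B) q'' ->
         qequiv z (qmul q q') q''),
      (* injective *)
      (forall A A' q q', unitaryR z A -> unitaryR z A' ->
         phi_rel z A q -> phi_rel z A' q' -> qequiv z q q' -> scal_equiv z A A') &
      (* image = image of Mtilde_n^x in H_n^x / F_n^x *)
      (forall A q, unitaryR z A -> phi_rel z A q ->
         exists m, inMunit z m /\ qequiv z m q) /\
      (forall m, inMunit z m ->
         exists A q, [/\ unitaryR z A, phi_rel z A q & qequiv z m q])].
Proof.
move=> [s Dn] n8 pz.
have cn : cyclo_order n.
  (* For [s <= 1] the order would be at most 6. *)
  case: s Dn => [|[|s]] Dn; last by exists s.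
    by move: n8; case: Dn => ->.
  by move: n8; case: Dn => ->.
split.
- split=> [A /(phi_unit n z cn pz)[q [? _]]|]; first by exists q.
  move=> A A' q q' _ _ [l [Rl ll DA]].
  exact: (qequiv_scal n z pz _ _ _ _ l (Zadj_Qadj _ _ Rl) ll DA).
- by move=> A B q q' q'' _ _; apply: phi_mul pz _ _ _ _ _.
- exact: phi_inj pz.
- split=> [A q uA Aq|m Um].
    have [m [Am Um]] := phi_unit n z cn pz A uA; exists m; split=> //.
    (* [m] and [q] represent the same matrix for possibly different [beta]. *)
    apply: (qequiv_scal n z pz A A m q 1) => //.
    + exact: subring1 (subring_Qadj z).
    + by rewrite rmorph1 mulr1.
    + by rewrite scale1r.
  have [A [uA Am]] := phi_onto n z cn pz m Um.
  by exists A, m; split=> //; apply: qequiv_refl.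
Qed.
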